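(* Let $\mathbb{F}$ be a finite field of order $q$, let $N$ be a matroid with $k$ elements, let $B$ be a basis of $N$, and let $M$ be an $\mathbb{F}$-representable $N$-fragile matroid. Then there exist matroids $M_1$ and $M_2$ on the same ground set, both representable over the field of order $q^{2k^2}$, and elements $c,d\in E(M_1)$, such that $M_2$ is obtained from $M_1$ by relaxing a circuit-hyperplane and $M/ B\setminus (E(N)-B) = M_1/ c\setminus d$.
   Context: A matroid $M$ is $N$-fragile if $N$ is a minor of $M$ (meaning $N$ itself, on the ground set $E(N)\subseteq E(M)$, is equal to $M/C\setminus D$ for some disjoint $C,D$ with $C\cup D=E(M)-E(N)$; an isomorphic copy does not suffice), but there is no element $e\in E(M)$ such that $N$ is a minor of both $M\setminus e$ and $M/e$; equivalently, there is a unique partition $(C,D)$ of $E(M)-E(N)$ with $N=M/C\setminus D$. Relaxing a circuit-hyperplane $H$ of a matroid means forming the matroid whose bases are the bases of the original matroid together with $H$. *)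

(* Defs.v *)
From HB Require Import structures.
From mathcomp Require Import all_boot all_order all_algebra all_field.
From mathcomp Require Import finmap.

Set Implicit Arguments.
Unset Strict Implicit.
Unset Printing Implicit Defensive.

Open Scope fset_scope.

Section BaseExchange.

Variable U : choiceType.
Implicit Types (E B I X D : {fset U}) (Bs : {fset {fset U}}).

Definition base_exchange Bs : bool :=
  all (fun B1 => all (fun B2 =>
    all (fun x => has (fun y => y |` (B1 `\ x) \in Bs) (B2 `\` B1))
      (B1 `\` B2)) Bs) Bs.

(* A matroid is given by its ground set and its collection of bases.  The
   axioms are boolean, so that two matroids are equal as soon as they have the
   same ground set and the same bases (matroid_ext below). *)
Definition matroid_axioms E Bs : bool :=
  [&& all (fun B => B `<=` E) Bs, Bs != fset0 & base_exchange Bs].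

Lemma base_exchangeP Bs :
  reflect (forall B1 B2 x, B1 \in Bs -> B2 \in Bs -> x \in B1 `\` B2 ->
             exists2 y, y \in B2 `\` B1 & y |` (B1 `\ x) \in Bs)
          (base_exchange Bs).
Proof.
apply: (iffP allP) => [ex B1 B2 x B1s B2s xB|ex B1 B1s].
  by move: (ex _ B1s) => /allP/(_ _ B2s)/allP/(_ _ xB)/hasP.
apply/allP=> B2 B2s; apply/allP=> x xB; apply/hasP; exact: ex.
Qed.

Lemma fproperI B D x :
  x \in D -> x \notin B -> {subset B <= D} -> B `<` D.
Proof.
move=> xD xB /fsubsetP sBD; rewrite fproperE sBD /=.
by apply/fsubsetPn; exists x.
Qed.

Lemma card_exchange B x y :
  x \in B -> y \notin B -> #|` y |` (B `\ x)| = #|` B|.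
Proof.
move=> xB yB; rewrite cardfsU1 !inE negb_and (negbTE yB) orbT /=.
by rewrite (cardfsD1 x B) xB.
Qed.

Lemma leq_card_bases Bs B1 B2 :
  base_exchange Bs -> B1 \in Bs -> B2 \in Bs -> #|` B1| <= #|` B2|.
Proof.
move=> /base_exchangeP ex.
move: {2}#|` B1 `\` B2| (leqnn #|` B1 `\` B2|) => n.
elim: n B1 => [|n IHn] B1 le_n B1s B2s.
  apply: fsubset_leq_card; rewrite -fsetD_eq0 -cardfs_eq0.
  by rewrite -leqn0.
have [D0|/fset0Pn[x xD]] := eqVneq (B1 `\` B2) fset0.
  by apply: fsubset_leq_card; rewrite -fsetD_eq0 D0.
have [y yD Bs'] := ex _ _ _ B1s B2s xD.
move: (xD) (yD); rewrite !in_fsetD => /andP[xB2 xB1] /andP[yB1 yB2].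
rewrite -(card_exchange xB1 yB1); apply: IHn => //.
rewrite -ltnS; apply: leq_trans le_n; apply: fproper_ltn_card.
apply: (fproperI xD) => [|z].
  by rewrite !inE eqxx /= orbF xB2 /=; apply: contraNneq xB2 => ->.
rewrite !inE => /andP[zB2 /orP[/eqP zy|/andP[_ zB1]]].
  by rewrite zy yB2 in zB2.
by rewrite zB2.
Qed.

Lemma eq_card_bases Bs B1 B2 :
  base_exchange Bs -> B1 \in Bs -> B2 \in Bs -> #|` B1| = #|` B2|.
Proof. by move=> ex h1 h2; apply/eqP; rewrite eqn_leq !(leq_card_bases ex). Qed.

Lemma extend_in Bs I B B0 :
  base_exchange Bs -> B \in Bs -> I `<=` B -> B0 \in Bs ->
  exists2 B', B' \in Bs & (I `<=` B') && (B' `<=` I `|` B0).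
Proof.
move=> ex; move/base_exchangeP: (ex) => exP.
move: {2}#|` B `\` B0| (leqnn #|` B `\` B0|) => n.
elim: n B => [|n IHn] B le_n Bs1 sIB B0s.
  exists B => //; rewrite sIB /=.
  move: le_n; rewrite leqn0 cardfs_eq0 fsetD_eq0 => /fsubset_trans; apply.
  exact: fsubsetUr.
have [sub|/fsubsetPn[x xB]] := boolP (B `<=` I `|` B0).
  by exists B => //; rewrite sIB.
rewrite in_fsetU negb_or => /andP[xI xB0].
have xD : x \in B `\` B0 by rewrite in_fsetD xB0.
have [y yD Bs'] := exP _ _ _ Bs1 B0s xD.
move: yD; rewrite in_fsetD => /andP[yB yB0].
apply: IHn Bs' _ B0s.
  rewrite -ltnS; apply: leq_trans le_n; apply: fproper_ltn_card.
  apply: (fproperI xD) => [|z].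
    by rewrite !inE eqxx /= orbF xB0 /=; apply: contraNneq xB0 => ->.
  rewrite !inE => /andP[zB0 /orP[/eqP zy|/andP[_ zB]]].
    by rewrite zy yB0 in zB0.
  by rewrite zB0.
apply/fsubsetP=> z zI; rewrite !inE (fsubsetP sIB _ zI) andbT.
by rewrite (contraNneq _ xI) ?orbT // => <-.
Qed.

Lemma augment Bs B1 B2 I1 I2 :
  base_exchange Bs -> B1 \in Bs -> B2 \in Bs -> I1 `<=` B1 -> I2 `<=` B2 ->
  #|` I1| < #|` I2| ->
  exists2 y, y \in I2 `\` I1 & exists2 B, B \in Bs & y |` I1 `<=` B.
Proof.
move=> ex B1s B2s s1 s2 lt12.
have [B Bbs /andP[s1B sB]] := extend_in ex B1s s1 B2s.
have [BI0|/fset0Pn[y]] := eqVneq (B `&` (I2 `\` I1)) fset0; last first.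
  rewrite in_fsetI => /andP[yB yI]; exists y => //; exists B => //.
  by rewrite fsubUset fsub1set yB.
suff: #|` B| < #|` B2| by rewrite (eq_card_bases ex Bbs B2s) ltnn.
have sB' : B `<=` I1 `|` (B2 `\` I2).
  apply/fsubsetP=> z zB; move: (fsubsetP sB _ zB); rewrite !inE.
  case: (boolP (z \in I1)) => //= zI1 ->; rewrite andbT.
  apply/negP=> zI2; have: z \in B `&` (I2 `\` I1) by rewrite !inE zB zI1.
  by rewrite BI0.
apply: leq_ltn_trans (fsubset_leq_card sB') _.
apply: (@leq_ltn_trans (#|` I1| + #|` B2 `\` I2|)).
  by rewrite -cardfsUI leq_addr.
rewrite -(cardfsID I2 B2) ltn_add2r.
by rewrite (fsetIidPr s2).
Qed.

End BaseExchange.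

Record matroid (U : choiceType) := Matroid {
  ground : {fset U};
  bases : {fset {fset U}};
  matroidP : matroid_axioms ground bases
}.

Section Matroids.

Variable U : choiceType.
Implicit Types (M N : matroid U) (A B C D X Y H : {fset U}).

Lemma matroid_ext M N : ground M = ground N -> bases M = bases N -> M = N.
Proof.
case: M N => [E Bs p] [E' Bs' p'] /= eE eBs.
by case: E' / eE p' => p'; case: Bs' / eBs p' => p'; rewrite (bool_irrelevance p p').
Qed.

Lemma base_sub M B : B \in bases M -> B `<=` ground M.
Proof. by case: M => E Bs /= /and3P[/allP sub _ _]; apply: sub. Qed.

Lemma bases_neq0 M : bases M != fset0.
Proof. by case: M => E Bs /= /and3P[]. Qed.

Lemma bases_exchange M : base_exchange (bases M).
Proof. by case: M => E Bs /= /and3P[]. Qed.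

Definition dual_bases M : {fset {fset U}} :=
  [fset ground M `\` B | B in bases M].

Lemma dual_axioms M : matroid_axioms (ground M) (dual_bases M).
Proof.
have ex := bases_exchange M; apply/and3P; split.
- by apply/allP=> _ /imfsetP[B _ ->]; apply: fsubsetDl.
- have /fset0Pn[B Bb] := bases_neq0 M.
  by apply/fset0Pn; exists (ground M `\` B); apply: in_imfset.
apply/base_exchangeP=> _ _ x /imfsetP[B1 /= B1s ->] /imfsetP[B2 /= B2s ->].
have sB1 := fsubsetP (base_sub B1s); have sB2 := fsubsetP (base_sub B2s).
rewrite !inE => /andP[]; rewrite negb_and negbK => xB /andP[xB1 xE].
have {}xB2 : x \in B2 by move: xB; rewrite xE orbF.
have sI : x |` (B1 `&` B2) `<=` B2 by rewrite fsubUset fsub1set xB2 fsubsetIr.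
have [B3 B3s /andP[sI3 s3]] := extend_in ex B2s sI B1s.
have x3 : x \in B3 by apply: (fsubsetP sI3); rewrite !inE eqxx.
have s3' z : z \in B3 -> (z == x) || (z \in B1).
  move/(fsubsetP s3); rewrite !inE => /orP[/orP[->//|/andP[->]]|->];
  by rewrite orbT.
have /fsubsetPn[y y1 y3] : ~~ (B1 `<=` B3).
  apply/negP=> s13; have: B1 == B3.
    by rewrite eqEfcard s13 (eq_card_bases ex B3s B1s) leqnn.
  by move/eqP=> e; rewrite e x3 in xB1.
have yx : y != x by apply: contraNneq y3 => ->.
have y2 : y \notin B2.
  by apply: contra y3 => y2; apply: (fsubsetP sI3); rewrite !inE y1 y2 orbT.
exists y; first by rewrite !inE y1 y2 sB1.
have -> : y |` ((ground M `\` B1) `\ x) = ground M `\` B3; last exact: in_imfset.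
have e3 : B3 = x |` (B1 `\ y).
  apply/eqP; rewrite eqEfcard (card_exchange y1 xB1).
  rewrite (eq_card_bases ex B1s B3s) leqnn andbT.
  apply/fsubsetP=> z z3; rewrite !inE; have /orP[->//|->] := s3' z z3.
  by rewrite andbT (contraNneq _ y3) ?orbT // => <-.
apply/fsetP=> z; rewrite e3 !inE.
have [->|zy] := eqVneq z y; first by rewrite (negbTE yx) (sB1 _ y1).
by case: (z == x).
Qed.

Definition dual M : matroid U := Matroid (dual_axioms M).

Definition deletion_bases M D : {fset {fset U}} :=
  let Xs := [fset B `\` D | B in bases M] in
  [fset X in Xs | all (fun Y => ~~ (X `<` Y)) Xs].

Lemma deletion_basesP M D X :
  reflect
    ((exists2 B, B \in bases M & X = B `\` D) /\
     forall B, B \in bases M -> #|` B `\` D| <= #|` X|)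
    (X \in deletion_bases M D).
Proof.
have ex := bases_exchange M.
rewrite /deletion_bases !inE /=; apply: (iffP andP) => [[]|[]].
  case/imfsetP=> B /= Bb -> /allP mx; split=> [|B2 B2b]; first by exists B.
  rewrite leqNgt; apply/negP=> lt.
  have [y] := augment ex Bb B2b (fsubsetDl _ D) (fsubsetDl _ D) lt.
  rewrite !inE => /andP[yBD /andP[yD _]] [B3 B3b s3].
  have /mx/negP[] : B3 `\` D \in [fset B `\` D | B in bases M].
    exact: in_imfset.
  apply: (@fproperI _ _ _ y) => [||z zB].
  - by rewrite in_fsetD yD; apply: (fsubsetP s3); rewrite !inE eqxx.
  - by rewrite in_fsetD.
  rewrite in_fsetD (fsubsetP s3) ?in_fset1U ?zB ?orbT ?andbT //.
  by move: zB; rewrite !inE => /andP[->].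
case=> B Bb -> mx; split; first exact: in_imfset.
apply/allP=> _ /imfsetP[B2 /= B2b ->]; apply/negP=> /fproper_ltn_card.
by rewrite ltnNge mx.
Qed.

Lemma deletion_axioms M D :
  matroid_axioms (ground M `\` D) (deletion_bases M D).
Proof.
have ex := bases_exchange M; apply/and3P; split.
- apply/allP=> _ /deletion_basesP[[B Bb ->] _].
  by apply: fsetSD; apply: base_sub.
- have /fset0Pn[B0 B0b] := bases_neq0 M; apply/fset0Pn.
  have exm : exists n, has (fun B => #|` B `\` D| == n) (bases M).
    by exists #|` B0 `\` D|; apply/hasP; exists B0.
  have ub n : has (fun B => #|` B `\` D| == n) (bases M) -> n <= #|` B0|.
    case/hasP=> B Bb /eqP <-; rewrite -(eq_card_bases ex Bb B0b).
    exact: fsubset_leq_card (fsubsetDl _ _).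
  case: (ex_maxnP exm ub) => n /hasP[B Bb /eqP eB] mx.
  exists (B `\` D); apply/deletion_basesP; split; first by exists B.
  by move=> B2 B2b; rewrite eB; apply: mx; apply/hasP; exists B2.
apply/base_exchangeP=> X1 X2 x X1b X2b xX.
have /deletion_basesP[[B1 B1b e1] mx1] := X1b.
have /deletion_basesP[[B2 B2b e2] mx2] := X2b.
move: xX; rewrite in_fsetD => /andP[xX2 xX1].
have s1 : X1 `\ x `<=` B1.
  by rewrite e1; apply: fsubset_trans (fsubsetDl _ _) (fsubsetDl _ _).
have s2 : X2 `<=` B2 by rewrite e2 fsubsetDl.
have lt : #|` X1 `\ x| < #|` X2|.
  apply: leq_trans (mx2 _ B1b); rewrite -e1.
  by rewrite (cardfsD1 x X1) xX1.
have [y] := augment ex B1b B2b s1 s2 lt.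
rewrite !inE negb_and negbK => /andP[yX yX2] [B3 B3b s3].
have yx : y != x by apply: contraNneq xX2 => <-.
have yX1 : y \notin X1 by move: yX; rewrite (negbTE yx).
exists y; first by rewrite in_fsetD yX1.
have c3 : #|` y |` (X1 `\ x)| = #|` X1| by apply: card_exchange.
apply/deletion_basesP; split; last by rewrite c3.
exists B3 => //; apply/eqP; rewrite eqEfcard c3 mx1 // andbT.
apply/fsubsetP=> z zX; rewrite in_fsetD (fsubsetP s3 _ zX) andbT.
move: zX; rewrite !inE => /orP[/eqP->|/andP[_]].
  by move: yX2; rewrite e2 in_fsetD => /andP[].
by rewrite e1 in_fsetD => /andP[].
Qed.

Definition deletion M D : matroid U := Matroid (deletion_axioms M D).

Definition contraction M C : matroid U := dual (deletion (dual M) C).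

Definition is_minor N M : Prop :=
  ground N `<=` ground M /\
  exists C D, [/\ [disjoint C & D]%fset, C `|` D = ground M `\` ground N
                & N = deletion (contraction M C) D].

Definition fragile N M : Prop :=
  is_minor N M /\
  ~ exists e, [/\ e \in ground M, is_minor N (deletion M [fset e])
                & is_minor N (contraction M [fset e])].

Definition independent M X : bool := has (fun B => X `<=` B) (bases M).

Definition rank M X : nat := \max_(B <- bases M) #|` B `&` X|.

Definition circuit M X : Prop :=
  [/\ X `<=` ground M, ~~ independent M X
    & forall Y, Y `<` X -> independent M Y].

Definition flat M X : Prop :=
  X `<=` ground M /\
  forall e, e \in ground M `\` X -> rank M (e |` X) <> rank M X.

Definition hyperplane M X : Prop :=
  flat M X /\ (rank M X).+1 = rank M (ground M).

Definition relaxation_at M H M' : Prop :=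
  [/\ circuit M H, hyperplane M H, ground M' = ground M
    & bases M' = H |` bases M].

(* The vectors v x are the columns, labelled by the elements of the ground
   set, of a representing matrix with r rows. *)
Definition representable (F : fieldType) M : Prop :=
  exists (r : nat) (v : U -> 'cV[F]_r),
    forall X, X `<=` ground M -> independent M X = free [seq v x | x <- X].

End Matroids.

(* Main.v *)
Require Import Defs.
From HB Require Import structures.
From mathcomp Require Import all_boot all_order all_algebra all_field.
From mathcomp Require Import fingroup cyclic finmap zify.

Set Implicit Arguments.
Unset Strict Implicit.
Unset Printing Implicit Defensive.

(** Write N = M / C \ D and represent M over F by vectors v, with dual basis f0
    for the basis B + C of M.  Fragility says that no other set can play the
    role of C.  Let Q be the linear map that forgets the B-coordinates of a
    vector except for one generic combination of them, with coefficients x_i in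
    K, recorded as a new coordinate with basis vector c.  The columns Q (v e),
    for e in C + D, together with c and with a generic combination, with
    coefficients y_j, of the images of the vectors of E(N) - B projected on the
    span of C (the column d) represent M1; adding om * c to the column d gives
    M2, and the circuit-hyperplane is C + d.  The two matroids can only differ
    on a set X + d such that B + X is a basis of M.  There the two determinants
    are, up to a common factor, sum_ij x_i y_j Z_ij and the same plus om, where
    Z is the difference of the B-coordinates of E(N) - B along the span of X and
    along the span of C.  If X <> C then Z is nonzero, as otherwise
    N = M / X \ (C + D - X).  Hence the determinants do not vanish when om and
    the products x_i y_j are linearly independent over F, which distinct powers
    of a generator of the multiplicative group of K achieve. *)

(** * Rank functions of minors, and uniqueness of the contracted set in fragile matroids *)

Section MatroidRank.
Local Open Scope nat_scope.

Variable U : choiceType.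
Implicit Types (M N : matroid U) (B C D E H I X Y : {fset U}).

Lemma fsetUD_sub X Y : X `<=` Y -> X `|` (Y `\` X) = Y.
Proof.
move=> /fsubsetP sXY; apply/fsetP=> z; rewrite !inE.
by have [/sXY|] := boolP (z \in X).
Qed.

Lemma leq_rank M B X : B \in bases M -> #|` B `&` X| <= rank M X.
Proof. by move=> Bb; apply: (leq_bigmax_seq (F := fun B => #|` B `&` X|) B Bb).
  Qed.

Lemma rank_attained M X : exists2 B, B \in bases M & #|` B `&` X| = rank M X.
Proof.
have /fset0Pn[B0 B0b] := bases_neq0 M.
have : exists2 B, B \in (bases M : seq _) & rank M X <= #|` B `&` X|.
  rewrite /rank; have : B0 \in enum_fset (bases M) by [].
  elim: (enum_fset (bases M)) B0 {B0b} => // B s IHs _ _.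
  rewrite big_cons; case: s IHs => [_|B' s IHs].
    by exists B; rewrite ?mem_head // big_nil maxn0.
  have [|B2 B2s le2] := IHs B'; first exact: mem_head.
  case: (leqP #|` B `&` X| (\max_(B <- B' :: s) #|` B `&` X|)) => _.
    by exists B2; rewrite // in_cons B2s orbT.
  by exists B; rewrite ?mem_head.
case=> B Bb le; exists B => //; apply/eqP.
by rewrite eqn_leq le leq_rank.
Qed.

Lemma independentE M X : independent M X = (rank M X == #|` X|).
Proof.
apply/hasP/eqP => [[B Bb sXB]|e].
  have := leq_rank X Bb; rewrite (fsetIidPr sXB) => le; apply/eqP.
  rewrite eqn_leq le andbT; have [B' _ <-] := rank_attained M X.
  by rewrite fsubset_leq_card // fsubsetIr.
have [B Bb eB] := rank_attained M X; exists B => //.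
have /eqP <- : B `&` X == X by rewrite eqEfcard fsubsetIr eB e leqnn.
exact: fsubsetIl.
Qed.

Lemma base_independent M B : B \in bases M -> independent M B.
Proof. by move=> Bb; apply/hasP; exists B. Qed.

Lemma independent_sub M X : independent M X -> X `<=` ground M.
Proof. by case/hasP=> B /base_sub sB sX; apply: fsubset_trans sX sB. Qed.

Lemma basesE M B0 X : B0 \in bases M ->
  (X \in bases M) = independent M X && (#|` X| == #|` B0|).
Proof.
move=> B0b; apply/idP/andP=> [Xb|[/hasP[B Bb sXB] /eqP eX]].
  by rewrite base_independent // (eq_card_bases (bases_exchange M) Xb B0b).
suff /eqP -> : X == B by [].
by rewrite eqEfcard sXB eX (eq_card_bases (bases_exchange M) Bb B0b) leqnn.
Qed.

(** Bases are the independent sets of basis size, and these sizes agree because a basis of either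
    matroid lies in a basis of the other. *)
Lemma eq_matroid M N : ground M = ground N ->
  (forall X, X `<=` ground M -> independent M X = independent N X) -> M = N.
Proof.
move=> eE eI0; apply: matroid_ext => //.
have eI X : independent M X = independent N X.
  have [/eI0//|nX] := boolP (X `<=` ground M).
  rewrite (contraNF (@independent_sub M X) nX).
  by rewrite (contraNF (@independent_sub N X)) -?eE.
have /fset0Pn[B Bb] := bases_neq0 M.
have /hasP[B' B'b sB] : independent N B by rewrite -eI base_independent.
have /hasP[B2 B2b sB'] : independent M B' by rewrite eI base_independent.
have eB : #|` B'| = #|` B|.
  apply/eqP; rewrite eqn_leq (fsubset_leq_card sB) andbT.
  rewrite (eq_card_bases (bases_exchange M) Bb B2b).
  exact: fsubset_leq_card.
by apply/fsetP=> X; rewrite (basesE X Bb) (basesE X B'b) eI eB.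
Qed.

(* Extending an optimal basis for X by elements of a basis that is optimal for
   E only loses elements outside E. *)
Lemma rank_chain M X E : X `<=` E ->
  exists B, [/\ B \in bases M, #|` B `&` X| = rank M X & #|` B `&` E| = rank M
    E].
Proof.
move=> sXE; have [B0 B0b e0] := rank_attained M X.
have [B1 B1b e1] := rank_attained M E.
have [B Bb /andP[sIB sB]] :=
  extend_in (bases_exchange M) B0b (fsubsetIl B0 X) B1b.
exists B; split=> //; apply/eqP; rewrite eqn_leq leq_rank //=.
  rewrite -e0; apply: fsubset_leq_card; apply/fsubsetP=> z zB.
  rewrite in_fsetI (fsubsetP sIB _ zB).
  by move: zB; rewrite in_fsetI => /andP[].
have: #|` B `\` E| <= #|` B1 `\` E|.
  apply: fsubset_leq_card; apply/fsubsetP=> z; rewrite !in_fsetD.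
  case/andP=> zE /(fsubsetP sB); rewrite !inE zE /= => /orP[|//].
  by case/andP=> _ /(fsubsetP sXE); rewrite (negPf zE).
have := eq_card_bases (bases_exchange M) Bb B1b.
rewrite -(cardfsID E B) -(cardfsID E B1) e1; lia.
Qed.

(** A basis optimal at once for [X] and for the complement of [D] has a maximal trace off [D], hence
    gives a basis of the deletion. *)
Lemma rank_deletion M D X : X `<=` ground M `\` D ->
  rank (deletion M D) X = rank M X.
Proof.
move=> sX; have disj : forall Y, #|` (Y `\` D) `&` X| = #|` Y `&` X|.
  move=> Y; congr (#|` _|); apply/fsetP=> z; rewrite !inE.
  have [/(fsubsetP sX)|] := boolP (z \in X); last by rewrite !andbF.
  by rewrite in_fsetD => /andP[-> _].
apply/eqP; rewrite eqn_leq; apply/andP; split.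
  have [_ /deletion_basesP[[B Bb ->] _] <-] := rank_attained (deletion M D) X.
  by rewrite disj leq_rank.
have [B [Bb eX eD]] := rank_chain M sX.
rewrite -eX -disj; apply: leq_rank; apply/deletion_basesP; split;
  first by exists B.
have sub B' : B' \in bases M -> B' `\` D = B' `&` (ground M `\` D).
  move=> B'b; apply/fsetP=> z; rewrite !inE.
  by have [/(fsubsetP (base_sub B'b)) ->|] := boolP (z \in B');
    rewrite ?andbT ?andbF.
by move=> B' B'b; rewrite (sub _ B'b) (sub _ Bb) eD leq_rank.
Qed.

(** Contraction is dual deletion: complementing twice turns maximality of the trace of a cobasis off
    [C] into maximality of the trace of [B] on [C], by the count [cardE]. *)
Lemma contraction_basesP M C X : C `<=` ground M ->
  reflect (exists2 B, B \in bases M & #|` B `&` C| = rank M C /\ X = B `\` C)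
          (X \in bases (contraction M C)).
Proof.
move=> sC.
have setE B : B \in bases M ->
    (ground M `\` C) `\` ((ground M `\` B) `\` C) = B `\` C.
  move=> Bb; apply/fsetP=> z; rewrite !inE.
  have := fsubsetP (base_sub Bb) z; case: (z \in B) => [->//|_] /=.
    by rewrite ?andbT ?andbF ?negb_and ?negbK; case: (z \in C).
  by case: (z \in C); case: (z \in ground M).
have cardE B : B \in bases M ->
    #|` (ground M `\` B) `\` C| + #|` ground M `&` C| + #|` B|
    = #|` ground M| + #|` B `&` C|.
  move=> Bb.
  have e1 := cardfsID B (ground M); rewrite (fsetIidPr (base_sub Bb)) in e1.
  have e2 := cardfsID C (ground M `\` B).
  have e3 := cardfsID B C.
  have e4 : (ground M `\` B) `&` C = C `\` B.
    apply/fsetP=> z; rewrite !inE; case: (boolP (z \in C)) => [zC|];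
      rewrite ?andbF //.
    by rewrite (fsubsetP sC) ?andbT.
  rewrite e4 in e2; rewrite (fsetIidPr sC).
  rewrite fsetIC in e3; lia.
apply: (iffP (imfsetP _ _ _ _)) => [[_ /deletion_basesP[[_ /imfsetP[B /= Bb ->]
  ->] mx] ->]|].
  exists B => //; split; last by rewrite /= setE.
  apply/eqP; rewrite eqn_leq leq_rank //=;
    have [B' B'b <-] := rank_attained M C.
  have /mx : ground M `\` B' \in dual_bases M by apply: in_imfset.
  have := cardE _ Bb; have := cardE _ B'b.
  have := eq_card_bases (bases_exchange M) Bb B'b; lia.
case=> B Bb [eB ->]; exists ((ground M `\` B) `\` C); last by rewrite /= setE.
apply/deletion_basesP; split; first by exists (ground M `\` B) => //;
  apply: in_imfset.
move=> _ /imfsetP[B' /= B'b ->].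
have := cardE _ Bb; have := cardE _ B'b; have := leq_rank C B'b.
have := eq_card_bases (bases_exchange M) Bb B'b; lia.
Qed.

(** By [rank_chain], a single basis attains the ranks of [C] and of their union, and its part off
    [C] then attains the third rank. *)
Lemma rank_contraction M C X : C `<=` ground M -> [disjoint X & C]%fset ->
  rank (contraction M C) X + rank M C = rank M (X `|` C).
Proof.
move=> sC dXC; have split_card B :
    #|` B `&` (X `|` C)| = #|` (B `\` C) `&` X| + #|` B `&` C|.
  rewrite -(cardfsID C) addnC; congr addn; congr (#|` _|);
    apply/fsetP=> z; rewrite !inE.
    have [zX|] := boolP (z \in X); last by case: (z \in C); rewrite ?andbF.
    by rewrite (negPf (fdisjointP dXC _ zX)) /= andbT.
  by case: (z \in C); rewrite ?andbF ?andbT ?orbT ?andbT.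
apply/eqP; rewrite eqn_leq; apply/andP; split.
  have [_ /(contraction_basesP _ sC)[B Bb [eB ->]] <-] :=
    rank_attained (contraction M C) X.
  by rewrite -eB -split_card leq_rank.
have [B [Bb eC eX]] := rank_chain M (fsubsetUr X C).
rewrite -eX split_card eC leq_add2r; apply: leq_rank.
by apply/contraction_basesP => //; exists B.
Qed.

Lemma minor_independent M C D X :
  C `<=` ground M -> X `<=` (ground M `\` C) `\` D ->
  independent (deletion (contraction M C) D) X
  = (rank M (X `|` C) == #|` X| + rank M C).
Proof.
move=> sC sX; rewrite independentE rank_deletion //.
rewrite -rank_contraction ?eqn_add2r //.
apply/fdisjointP=> z /(fsubsetP sX); rewrite !inE.
by case/and3P.
Qed.

(** This trades an equality of matroids for rank conditions in [M], which become dimension counts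
    once [M] is represented. *)
Lemma minorP N M C D : C `<=` ground M -> ground N = (ground M `\` C) `\` D ->
  (N = deletion (contraction M C) D) <->
  (forall X, X `<=` ground N ->
     independent N X = (rank M (X `|` C) == #|` X| + rank M C)).
Proof.
move=> sC eG; split=> [eN X|eI].
  by rewrite eG => sX; rewrite eN minor_independent.
apply: eq_matroid => // X sX.
by rewrite eI // minor_independent // -eG.
Qed.

(** An element of [C] outside [C'] lies in [D']; it is contracted in one presentation of [N] and
    deleted in the other, which fragility forbids. *)
Lemma fragile_contract_sub N M C C' D D' : fragile N M ->
  [disjoint C & D]%fset -> C `|` D = ground M `\` ground N ->
  [disjoint C' & D']%fset -> C' `|` D' = ground M `\` ground N ->
  N = deletion (contraction M C) D -> N = deletion (contraction M C') D' ->
  C `<=` C'.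
Proof.
move=> [[sNM _] frag] dis eU dis' eU' eN eN'; apply/fsubsetP=> e eC.
have mem z : (z \in C) || (z \in D) = (z \notin ground N) && (z \in ground M).
  by have /fsetP/(_ z) := eU; rewrite !inE.
have mem' z : (z \in C') || (z \in D') = (z \notin ground N) && (z \in ground
  M).
  by have /fsetP/(_ z) := eU'; rewrite !inE.
have nCD z : z \in C -> z \notin D by apply: fdisjointP.
have nCD' z : z \in C' -> z \notin D' by apply: fdisjointP.
have := mem e; rewrite eC /= => /esym/andP[eN0 eM].
have sC : C `<=` ground M.
  by apply/fsubsetP=> z zC; have := mem z; rewrite zC /= => /esym/andP[].
have sC' : C' `<=` ground M.
  by apply/fsubsetP=> z zC; have := mem' z; rewrite zC /= => /esym/andP[].
have gN : ground N = (ground M `\` C) `\` D.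
  apply/fsetP=> z; rewrite !inE; have := mem z; have := fsubsetP sNM z.
  by case: (z \in ground N) (z \in C) (z \in D) (z \in ground M) => [] [] [] []
    //= h; have := h isT.
have gN' : ground N = (ground M `\` C') `\` D'.
  apply/fsetP=> z; rewrite !inE; have := mem' z; have := fsubsetP sNM z.
  by case: (z \in ground N) (z \in C') (z \in D') (z \in ground M) => [] [] []
    [] //= h; have := h isT.
have /(minorP sC gN) iN := eN; have /(minorP sC' gN') iN' := eN'.
have se : [fset e] `<=` ground M by rewrite fsub1set.
apply/negPn/negP=> eC'; case: frag; exists e; split=> //.
  have eD' : e \in D' by have := mem' e; rewrite (negPf eC') eN0 eM.
  split.
    apply/fsubsetP=> z zN; rewrite !inE (fsubsetP sNM _ zN) andbT.
    by apply: contraNneq eN0 => <-.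
  have sC'e : C' `<=` ground (deletion M [fset e]).
    apply/fsubsetP=> z zC; rewrite !inE (fsubsetP sC' _ zC) andbT.
    by apply: contraNneq eC' => <-.
  exists C', (D' `\ e); split.
  - apply/fdisjointP=> z /nCD' zD; rewrite !inE (negPf zD) andbF //.
  - apply/fsetP=> z; rewrite !inE; have := mem' z.
    have [->|] := eqVneq z e; rewrite //= (negPf eC') ?andbF //.
  apply/minorP=> //.
    by apply/fsetP=> z; rewrite gN' !inE; have [->|] := eqVneq z e;
      rewrite //= eD' ?andbF.
  move=> X sX; rewrite iN' // !rank_deletion //.
  rewrite fsubUset sC'e andbT; apply/fsubsetP=> z /(fsubsetP sX) zN.
  rewrite !inE (fsubsetP sNM _ zN) andbT.
  by apply: contraNneq eN0 => <-.
have sCe : C `\ e `<=` ground (contraction M [fset e]).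
  by rewrite fsetSD.
split.
  apply/fsubsetP=> z zN; rewrite !inE (fsubsetP sNM _ zN) andbT.
  by apply: contraNneq eN0 => <-.
exists (C `\ e), D; split.
- by apply/fdisjointP=> z; rewrite !inE => /andP[_ /nCD].
- apply/fsetP=> z; rewrite !inE; have := mem z.
  have [->|] := eqVneq z e; rewrite //= (negPf (nCD _ eC)) ?andbF //.
apply/minorP=> //.
  by apply/fsetP=> z; rewrite gN !inE; have [->|] := eqVneq z e;
    rewrite //= eC ?andbF.
move=> X sX; rewrite iN //.
have eX : [disjoint X `|` C `\ e & [fset e]]%fset.
  rewrite fdisjointX1 !inE eqxx /= orbF.
  by apply: contra eN0 => /(fsubsetP sX).
have e1 : [disjoint C `\ e & [fset e]]%fset by rewrite fdisjointX1 !inE eqxx.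
have := rank_contraction se eX; have := rank_contraction se e1.
rewrite -fsetUA [_ `|` [fset e]]fsetUC fsetD1K // => <- <-.
by rewrite addnA eqn_add2r.
Qed.

(** The form in which fragility is used: if contracting [C'] leaves the same subsets of [ground N]
    independent, then [C'] also yields [N], and the previous inclusion applies in both
    directions. *)
Lemma fragile_unique N M C C' D : fragile N M ->
  [disjoint C & D]%fset -> C `|` D = ground M `\` ground N ->
  N = deletion (contraction M C) D -> C' `<=` C `|` D ->
  (forall X, X `<=` ground N ->
     (rank M (X `|` C) == #|` X| + rank M C)
     = (rank M (X `|` C') == #|` X| + rank M C')) ->
  C' = C.
Proof.
move=> frag dis eU eN sC' eI; have [[sNM _] _] := frag.
pose D' := (C `|` D) `\` C'.
have dis' : [disjoint C' & D']%fset by apply/fdisjointP=> z zC; rewrite !inE zC.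
have eU' : C' `|` D' = ground M `\` ground N by rewrite fsetUD_sub.
have sCM : C `|` D `<=` ground M by rewrite eU fsubsetDl.
have gNM C1 D1 : C1 `|` D1 = ground M `\` ground N -> ground N = ground M `\`
  C1 `\` D1.
  by move=> e; rewrite fsetDDl e fsetDK.
have sC : C `<=` ground M by apply: fsubset_trans sCM; apply: fsubsetUl.
have eN' : N = deletion (contraction M C') D'.
  apply/(minorP (fsubset_trans sC' sCM) (gNM _ _ eU')) => X sX.
  by rewrite -eI //; move/(minorP sC (gNM _ _ eU)): eN; apply.
apply/eqP; rewrite eqEfsubset.
by rewrite (fragile_contract_sub frag dis' eU' dis eU) // (fragile_contract_sub
  frag dis eU dis' eU').
Qed.

End MatroidRank.

(** * Vector families indexed by labels, and the matroids they represent *)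

Section VectorFamilies.
Import GRing.Theory.
Local Open Scope ring_scope.

Variables (U : choiceType) (F : fieldType) (vT : vectType F).
Implicit Types (v : U -> vT) (A E X Y : {fset U}) (k : U -> F).

Definition fspan v X : {vspace vT} := <<[seq v x | x <- X]>>%VS.
Definition ffree v X : bool := free [seq v x | x <- X].

Lemma ffreeE v X : ffree v X = (\dim (fspan v X) == #|` X|).
Proof. by rewrite /ffree /free size_map cardfE -cardfE. Qed.

Lemma dim_fspan v X : (\dim (fspan v X) <= #|` X|)%N.
Proof. by apply: leq_trans (dim_span _) _; rewrite size_map. Qed.

Lemma ffree0 v : ffree v fset0.
Proof.
by rewrite ffreeE cardfs0 -leqn0 -[X in (_ <= X)%N](@cardfs0 U) dim_fspan.
Qed.

Lemma fspanS v X Y : X `<=` Y -> (fspan v X <= fspan v Y)%VS.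
Proof.
move=> /fsubsetP sXY; apply: sub_span => _ /mapP[x xX ->].
by apply: map_f; apply: sXY.
Qed.

Lemma mem_fspan v X x : x \in X -> v x \in fspan v X.
Proof. by move=> xX; apply/memv_span/map_f. Qed.

Lemma fspanU v X Y : fspan v (X `|` Y) = (fspan v X + fspan v Y)%VS.
Proof.
rewrite /fspan -span_cat -map_cat; apply: eq_span => u.
apply/mapP/mapP=> [] [x xX ->]; exists x => //; move: xX;
  by rewrite mem_cat in_fsetU.
Qed.

Lemma fspan1 v x : fspan v [fset x] = <[v x]>%VS.
Proof.
rewrite /fspan -span_seq1; apply: eq_span => u; rewrite inE.
by apply/mapP/eqP=> [[y /fset1P-> ->//]|->]; exists x; rewrite ?inE.
Qed.

Lemma fspan_sub v X (V : {vspace vT}) :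
  (forall x, x \in X -> v x \in V) -> (fspan v X <= V)%VS.
Proof. by move=> sXV; apply/span_subvP=> _ /mapP[x xX ->]; apply: sXV. Qed.

Lemma eq_in_fspan v v' X : {in X, v =1 v'} -> fspan v X = fspan v' X.
Proof. by move=> eqv; rewrite /fspan; congr (<<_>>%VS); apply/eq_in_map. Qed.

Lemma eq_in_ffree v v' X : {in X, v =1 v'} -> ffree v X = ffree v' X.
Proof. by move=> eqv; rewrite !ffreeE (eq_in_fspan eqv). Qed.

Lemma ffreeU1 v X x : x \notin X ->
  ffree v (x |` X) = (v x \notin fspan v X) && ffree v X.
Proof.
move=> xX; rewrite /ffree /fspan -free_cons -map_cons; apply: perm_free.
apply: perm_map; apply: uniq_perm; rewrite ?fset_uniq //= ?xX ?fset_uniq //.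
by move=> z; rewrite in_fset1U in_cons.
Qed.

Lemma ffree_sub v X Y : X `<=` Y -> ffree v Y -> ffree v X.
Proof.
move=> sXY; rewrite !ffreeE => /eqP eY.
have eU : Y = X `|` (Y `\` X) by rewrite fsetUD_sub.
have := dim_fspan v X; have := dim_fspan v (Y `\` X).
have := dimv_add_leqif (fspan v X) (fspan v (Y `\` X)) => /leqifP.
have := cardfsID X Y; rewrite (fsetIidPr sXY) -fspanU -eU eY.
by case: ifP => _; [move=> h1 /eqP h2 h3 h4|move=> h1 h2 h3 h4];
  rewrite eqn_leq h4 /=; move: h1 h2 h3; clear; lia.
Qed.

Lemma fspan_comb v X u : u \in fspan v X ->
  exists k, u = \sum_(x <- X) k x *: v x.
Proof.
rewrite /fspan; have := fset_uniq X; elim: (enum_fset X) u => [|x s IHs] u /=.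
  by rewrite span_nil memv0 => _ /eqP->; exists (fun=> 0); rewrite big_nil.
case/andP=> xs us; rewrite span_cons => /memv_addP[u1 /vlineP[a ->]] [u2 u2s
  ->].
have [k ->] := IHs _ us u2s; exists (fun z => if z == x then a else k z).
rewrite big_cons eqxx; congr (_ + _); apply: eq_big_seq => z zs.
by case: eqP => // zx; rewrite -zx zs in xs.
Qed.

Lemma comb_fspan v X k : \sum_(x <- X) k x *: v x \in fspan v X.
Proof.
by rewrite big_seq; apply: rpred_sum => x xX; apply/rpredZ/mem_fspan.
Qed.

Lemma exists_notin_fspan v X (V : {vspace vT}) :
  (\dim V < \dim (fspan v X))%N -> exists2 x, x \in X & v x \notin V.
Proof.
move=> lt_VX; have [/allP sV|/allPn[x xX vx]] := boolP (all (fun x => v x \in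
  V) X).
  by move: lt_VX; rewrite ltnNge dimvS // fspan_sub.
by exists x.
Qed.

Lemma ffree_extend v X E : X `<=` E -> ffree v X ->
  exists Y, [/\ X `<=` Y, Y `<=` E, ffree v Y & #|` Y| = \dim (fspan v E)].
Proof.
move: {2}(_ - _)%N (leqnn (\dim (fspan v E) - #|` X|)) => n.
elim: n X => [|n IHn] X le_n sXE fX;
  have eX := eqP (etrans (esym (ffreeE v X)) fX).
  exists X; split=> //; apply/eqP; rewrite eqn_leq -{1}eX dimvS ?fspanS //.
  by move: le_n; rewrite leqn0 subn_eq0.
have [le|lt] := leqP (\dim (fspan v E)) #|` X|.
  by apply: IHn; rewrite // (eqP le).
have [|y yE yX] := @exists_notin_fspan v E (fspan v X); first by rewrite eX.
have yX' : y \notin X by apply: contra yX; apply: mem_fspan.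
have [|||Y [sY sYE fY cY]] := IHn (y |` X).
- by rewrite cardfsU1 yX'; move: le_n; clear; lia.
- by rewrite fsubUset fsub1set yE.
- by rewrite ffreeU1 ?yX.
by exists Y; split=> //; apply: fsubset_trans sY; apply: fsubsetUr.
Qed.

Lemma ffreeP v X :
  reflect (forall k, \sum_(x <- X) k x *: v x = 0 -> {in X, forall x, k x = 0})
          (ffree v X).
Proof.
apply: (iffP idP) => [fX k s0 x xX|indep].
  apply/eqP/negPn/negP=> nz; move: fX.
  rewrite -(fsetD1K xX) ffreeU1 ?inE ?eqxx // => /andP[/negP h _]; apply: h.
  move: s0; rewrite (big_fsetD1 x) //= => /eqP; rewrite addr_eq0 => /eqP e.
  have -> : v x = (k x)^-1 *: (k x *: v x) by rewrite scalerA mulVf ?scale1r.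
  by rewrite e rpredZ // rpredN comb_fspan.
have [Y [_ sY fY cY]] := ffree_extend (fsub0set X) (ffree0 v).
have [<-//|nYX] := eqVneq Y X.
have /fsubsetPn[x xX xY] : ~~ (X `<=` Y) by rewrite eqEfsubset sY in nYX.
have : v x \in fspan v Y.
  have /eqP -> : fspan v Y == fspan v X; last exact: mem_fspan.
  by rewrite eqEdim fspanS // -cY; move: fY; rewrite ffreeE => /eqP->;
    rewrite leqnn.
(* Moving [v x] to the other side gives a relation on [X] whose coefficient at [x] is -1, not 0. *)
case/fspan_comb=> k e; pose k' z := if z == x then -1 else if z \in Y then k z
  else 0.
have /indep/(_ x xX)/eqP : \sum_(z <- X) k' z *: v z = 0.
  rewrite (big_fsetD1 x) //= /k' eqxx scaleN1r {1}e addrC; apply/eqP;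
    rewrite subr_eq0.
  apply/eqP/esym; apply: etrans (big_fset_incl _ _ _) => /=.
  - by apply: eq_big_seq => z zY; rewrite zY; case: eqP zY => // ->;
      rewrite (negPf xY).
  - by apply/fsubsetP=> z zY; rewrite !inE (fsubsetP sY _ zY) andbT;
      apply: contraNneq xY => <-.
  by move=> z; rewrite !inE => /andP[/negPf-> _] /negPf->; rewrite scale0r.
by rewrite /k' eqxx oppr_eq0 oner_eq0.
Qed.

Definition vec_bases v E : {fset {fset U}} :=
  [fset X in fpowerset E | ffree v X && (#|` X| == \dim (fspan v E))].

Lemma vec_basesP v E X :
  reflect [/\ X `<=` E, ffree v X & #|` X| = \dim (fspan v E)] (X \in vec_bases
    v E).
Proof.
rewrite !inE /= fpowersetE; apply: (iffP and3P) => [[? ? /eqP ?]|[? ? ->]].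
  by split.
by split.
Qed.

Lemma vec_matroid_axioms v E : matroid_axioms E (vec_bases v E).
Proof.
apply/and3P; split.
- by apply/allP=> X /vec_basesP[].
- have [Y [_ sY fY cY]] := ffree_extend (fsub0set E) (ffree0 v).
  by apply/fset0Pn; exists Y; apply/vec_basesP.
apply/base_exchangeP=> B1 B2 x /vec_basesP[s1 f1 c1] /vec_basesP[s2 f2 c2].
rewrite in_fsetD => /andP[xB2 xB1].
(* Without [x], the set [B1] spans a space of too small a dimension to contain all of [B2]. *)
have [|y yB2 yB1] := @exists_notin_fspan v B2 (fspan v (B1 `\ x)).
  apply: leq_ltn_trans (dim_fspan _ _) _.
  move: f2; rewrite ffreeE => /eqP->; rewrite c2 -c1.
  by rewrite [X in (_ < X)%N](cardfsD1 x) xB1.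
have yx : y != x by apply: contraNneq xB2 => <-.
have yB1' : y \notin B1.
  by apply: contra yB1 => yB1; apply: mem_fspan; rewrite !inE yx.
exists y; first by rewrite in_fsetD yB1'.
apply/vec_basesP; split.
- by rewrite fsubUset fsub1set (fsubsetP s2 _ yB2) (fsubset_trans (fsubsetDl _
    _) s1).
- rewrite ffreeU1 ?yB1 ?(ffree_sub (fsubsetDl _ _) f1) //.
  by apply: contra yB1; apply: mem_fspan.
by rewrite card_exchange.
Qed.

Definition vec_matroid v E : matroid U := Matroid (vec_matroid_axioms v E).

Lemma vec_matroid_independent v E X : X `<=` E ->
  independent (vec_matroid v E) X = ffree v X.
Proof.
move=> sX; apply/hasP/idP=> [[B /vec_basesP[_ fB _] sXB]|fX].
  exact: ffree_sub fB.
have [Y [sXY sY fY cY]] := ffree_extend sX fX.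
by exists Y => //; apply/vec_basesP.
Qed.

Lemma rank_fspan v M X :
  (forall Y, Y `<=` ground M -> independent M Y = ffree v Y) ->
  X `<=` ground M -> rank M X = \dim (fspan v X).
Proof.
move=> rep sX; apply/eqP; rewrite eqn_leq; apply/andP; split.
  have [B Bb <-] := rank_attained M X.
  have sBX : B `&` X `<=` ground M by apply: fsubset_trans (fsubsetIr _ _) sX.
  have : independent M (B `&` X) by apply/hasP; exists B => //;
    apply: fsubsetIl.
  rewrite rep // ffreeE => /eqP <-; apply: dimvS; apply: fspanS.
  exact: fsubsetIr.
have [Y [_ sY fY <-]] := ffree_extend (fsub0set X) (ffree0 v).
have /hasP[B Bb sYB] : independent M Y by rewrite rep // (fsubset_trans sY).
apply: leq_trans (leq_rank X Bb); apply: fsubset_leq_card.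
by apply/fsubsetP=> z zY; rewrite in_fsetI (fsubsetP sYB _ zY) (fsubsetP sY _
  zY).
Qed.

End VectorFamilies.

(** * Biorthogonal families of functionals *)

Section DualFamilies.
Import GRing.Theory.
Local Open Scope ring_scope.

Definition ap (F : fieldType) (r : nat) (f : 'rV[F]_r) (u : 'cV[F]_r) : F :=
  (f *m u) 0 0.

Lemma apB (F : fieldType) (r : nat) (f : 'rV[F]_r) (u u' : 'cV[F]_r) :
  ap f (u - u') = ap f u - ap f u'.
Proof. by rewrite /ap mulmxBr !mxE. Qed.

Lemma ap0r (F : fieldType) (r : nat) (f : 'rV[F]_r) : ap f 0 = 0.
Proof. by rewrite /ap mulmx0 mxE. Qed.

Lemma ap_sumr (F : fieldType) (r : nat) (f : 'rV[F]_r) (I : Type) (s : seq I)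
    (k : I -> F) (v : I -> 'cV[F]_r) :
  ap f (\sum_(x <- s) k x *: v x) = \sum_(x <- s) k x * ap f (v x).
Proof.
rewrite /ap mulmx_sumr summxE; apply: eq_bigr => x _.
by rewrite -scalemxAr mxE.
Qed.

Lemma ap_suml (F : fieldType) (r : nat) (u : 'cV[F]_r) (I : Type) (s : seq I)
    (k : I -> F) (f : I -> 'rV[F]_r) :
  ap (\sum_(x <- s) k x *: f x) u = \sum_(x <- s) k x * ap (f x) u.
Proof.
rewrite /ap mulmx_suml summxE; apply: eq_bigr => x _.
by rewrite -scalemxAl mxE.
Qed.

Lemma ap_map (F K : fieldType) (h : {rmorphism F -> K}) (r : nat)
    (f : 'rV[F]_r) (u : 'cV[F]_r) :
  ap (map_mx h f) (map_mx h u) = h (ap f u).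
Proof. by rewrite /ap -map_mxM mxE. Qed.

Lemma ap_row_col (F : fieldType) (r : nat) (a b : F) (f : 'rV[F]_r)
    (u : 'cV[F]_r) :
  ap (row_mx a%:M f) (col_mx b%:M u) = a * b + ap f u.
Proof. by rewrite /ap mul_row_col -scalar_mxM !mxE eqxx. Qed.

(** Such a family certifies freeness and can be mapped entrywise along a field embedding, which is
    how freeness passes from [F] to [K]. *)
Definition dual_family (U : choiceType) (F : fieldType) (r : nat)
    (v : U -> 'cV[F]_r) (f : U -> 'rV[F]_r) (X : {fset U}) : Prop :=
  {in X &, forall x y, ap (f x) (v y) = (x == y)%:R}.

Variables (U : choiceType) (F : fieldType) (r : nat).
Implicit Types (v : U -> 'cV[F]_r) (f : U -> 'rV[F]_r) (X Y : {fset U}).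

Lemma dual_comb v f X (k : U -> F) : dual_family v f X ->
  {in X, forall x, ap (f x) (\sum_(y <- X) k y *: v y) = k x}.
Proof.
move=> df x xX; rewrite ap_sumr (big_fsetD1 x) //= df // eqxx mulr1.
rewrite big_seq big1 ?addr0 // => y; rewrite !inE => /andP[yx yX].
by rewrite df // eq_sym (negPf yx) mulr0.
Qed.

Lemma dual_ffree v f X : dual_family v f X -> ffree v X.
Proof.
move=> df; apply/ffreeP=> k s0 x xX.
by rewrite -(dual_comb k df xX) s0 ap0r.
Qed.

Lemma dual_fspan v f X u : dual_family v f X -> u \in fspan v X ->
  u = \sum_(x <- X) ap (f x) u *: v x.
Proof.
move=> df /fspan_comb[k ->]; apply: eq_big_seq => x xX.
by rewrite dual_comb.
Qed.

(** Free vectors are the rows of a matrix with trivial left kernel, hence with a right inverse. *)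
Lemma ffree_dual v X : ffree v X -> exists f, dual_family v f X.
Proof.
move=> fX; pose n := size (enum_fset X).
have [X0|[x0 _]] := fset_0Vmem X.
  by exists (fun=> 0) => x y; rewrite X0.
pose A : 'M[F]_(n, r) := \matrix_(i, j) v (nth x0 X i) j 0.
have kerA (u : 'rV_n) : u *m A = 0 -> u = 0.
  move=> uA; move/ffreeP: fX.
  move=> /(_ (fun x => oapp (u 0) 0 (insub (index x X)))) fX.
  have {}fX : {in X, forall x, oapp (u 0) 0 (insub (index x X) : option 'I_n) =
    0}.
    apply: fX; apply/matrixP=> j z; rewrite ord1 summxE.
    have /matrixP/(_ 0 j) := uA; rewrite !mxE => uAj; rewrite -[RHS]uAj.
    rewrite (big_nth x0) big_mkord; apply: eq_bigr => i _.
    by rewrite !mxE index_uniq ?fset_uniq // valK.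
  apply/rowP=> i; rewrite mxE.
  have := fX (nth x0 X i); rewrite index_uniq ?fset_uniq // valK /=; apply.
  exact: mem_nth.
have [Z AZ] : exists Z, A *m Z = 1%:M.
  apply/row_freeP; rewrite -kermx_eq0; apply/rowV0P=> u /sub_kermxP.
  exact: kerA.
(* The functionals are the columns of the right inverse; the default 0 is met only for labels
   outside [X]. *)
exists (fun x => \row_j oapp (Z j) 0 (insub (index x X) : option 'I_n)) => x y
  xX yX.
have ltx : (index x X < n)%N by rewrite index_mem.
have lty : (index y X < n)%N by rewrite index_mem.
have /matrixP/(_ (Ordinal lty) (Ordinal ltx)) := AZ.
rewrite !mxE -val_eqE /= => e.
have -> : (x == y) = (index y X == index x X).
  by apply/eqP/eqP=> [->//|h]; rewrite -(nth_index x0 xX) -(nth_index x0 yX) h.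
rewrite -e /ap !mxE; apply: eq_bigr => j _.
by rewrite !mxE insubT /= nth_index // mulrC.
Qed.

End DualFamilies.

(** * Auxiliary sums, spans and block columns *)

Section MoreVectors.
Import GRing.Theory.
Local Open Scope ring_scope.

Lemma big_fsetU_disjoint (R : Type) (idx : R) (op : Monoid.com_law idx)
    (I : choiceType) (A B : {fset I}) (G : I -> R) :
  [disjoint A & B]%fset ->
  \big[op/idx]_(i <- A `|` B) G i
  = op (\big[op/idx]_(i <- A) G i) (\big[op/idx]_(i <- B) G i).
Proof.
move=> dAB; rewrite -big_cat; apply: perm_big; apply: uniq_perm.
- exact: fset_uniq.
- rewrite cat_uniq !fset_uniq andbT /=; apply/hasPn=> z zB.
  by apply/negP=> /(fdisjointP dAB); rewrite zB.
by move=> z; rewrite mem_cat in_fsetU.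
Qed.

Lemma ap_fspan0 (U : choiceType) (F : fieldType) (r : nat) (v : U -> 'cV[F]_r)
    (g : 'rV[F]_r) (X : {fset U}) (u : 'cV[F]_r) :
  {in X, forall x, ap g (v x) = 0} -> u \in fspan v X -> ap g u = 0.
Proof.
move=> g0 /fspan_comb[k ->]; rewrite ap_sumr big_seq big1 // => x xX.
by rewrite g0 // mulr0.
Qed.

Lemma comb_col (F : fieldType) (r : nat) (I : Type) (s : seq I) (k a : I -> F)
    (b : I -> 'cV[F]_r) :
  \sum_(e <- s) k e *: (col_mx (a e)%:M (b e) : 'cV_(1 + r))
  = col_mx (\sum_(e <- s) k e * a e)%:M (\sum_(e <- s) k e *: b e).
Proof.
elim: s => [|e s IHs]; first by rewrite !big_nil raddf0 col_mx0.
by rewrite !big_cons IHs scale_col_mx scale_scalar_mx add_col_mx -raddfD.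
Qed.

End MoreVectors.

(** * The two vector families over [K] and the relaxation between their matroids *)

Section Construction.
Import GRing.Theory.
Local Open Scope ring_scope.

Variables (U : choiceType) (F K : fieldType) (h : {rmorphism F -> K}) (r : nat).
Variables (v : U -> 'cV[F]_r) (f0 : U -> 'rV[F]_r) (B C D J : {fset U}).
Variables (x y : U -> K) (om : K) (c d : U).

Hypothesis disBC : [disjoint B & C `|` D]%fset.
Hypothesis disCD : [disjoint C & D]%fset.
Hypothesis df0 : dual_family v f0 (B `|` C).
Hypothesis vBC : {in D `|` J, forall e, v e \in fspan v (B `|` C)}.
Hypothesis nzC : {in C, forall e, exists2 j, j \in J & ap (f0 e) (v j) != 0}.
Hypothesis nzD : {in D, forall e, exists2 i, i \in B & ap (f0 i) (v e) != 0}.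
Hypothesis change : forall X f, X `<=` C `|` D -> #|` X| = #|` C| -> X != C ->
  dual_family v f (B `|` X) ->
  exists i j, [/\ i \in B, j \in J & ap (f i) (v j) != ap (f0 i) (v j)].
Hypothesis indep_x : forall z : U -> F,
  \sum_(i <- B) x i * h (z i) = 0 -> {in B, forall i, z i = 0}.
Hypothesis indep_y : forall z : U -> F,
  \sum_(j <- J) y j * h (z j) = 0 -> {in J, forall j, z j = 0}.
Hypothesis indep_yx : forall (z : U -> U -> F) (t : F),
  \sum_(j <- J) y j * (\sum_(i <- B) x i * h (z i j)) + om * h t = 0 ->
  {in B & J, forall i j, z i j = 0}.
Hypothesis nz_om : om != 0.
Hypothesis c_new : c \notin C `|` D.
Hypothesis d_new : d \notin C `|` D.
Hypothesis neq_cd : c != d.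

(** On the span of [B] and [C] this is the projection onto the span of [C] along that of [B]. *)
Definition kill_B (u : 'cV[F]_r) : 'cV[F]_r := u - \sum_(i <- B) ap (f0 i) u *:
  v i.

(** The image of [v e] under Q; the first row is the new coordinate. *)
Definition new_vec (e : U) : 'cV[K]_(1 + r) :=
  col_mx (\sum_(i <- B) x i * h (ap (f0 i) (v e)))%:M (map_mx h (kill_B (v e))).

Definition new_c : 'cV[K]_(1 + r) := col_mx 1%:M 0.

(** The parameter [o] is 0 for the first matroid and [om] for the relaxed one. *)
Definition new_d (o : K) : 'cV[K]_(1 + r) :=
  col_mx o%:M (\sum_(j <- J) y j *: map_mx h (kill_B (v j))).

Definition new_family (o : K) (e : U) : 'cV[K]_(1 + r) :=
  if e == c then new_c else if e == d then new_d o else new_vec e.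

Lemma new_family_c o : new_family o c = new_c. Proof. by rewrite /new_family
  eqxx. Qed.
Lemma new_family_d o : new_family o d = new_d o.
Proof. by rewrite /new_family eqxx eq_sym (negPf neq_cd). Qed.
Lemma new_familyE o e : e \in C `|` D -> new_family o e = new_vec e.
Proof.
by move=> eCD; rewrite /new_family; case: eqP => [ec|_];
  [|case: eqP => // ed]; [move: c_new|move: d_new]; rewrite -?ec -?ed eCD.
Qed.

(** The source of the matrix Z: on a projected vector, the functionals of another basis through [B]
    measure the change of the [B]-coordinates. *)
Lemma ap_kill_B_in (f : U -> 'rV[F]_r) i u : {in B &, forall i j, ap (f i) (v
  j) = (i == j)%:R} ->
  i \in B -> ap (f i) (kill_B u) = ap (f i) u - ap (f0 i) u.
Proof.
move=> df iB; rewrite /kill_B apB; congr (_ - _).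
rewrite ap_sumr (big_fsetD1 i) //= df // eqxx mulr1 big_seq big1 ?addr0 // => j.
by rewrite !inE => /andP[ji jB]; rewrite df // eq_sym (negPf ji) mulr0.
Qed.

Lemma ap_kill_B_out g u : {in B, forall i, ap g (v i) = 0} -> ap g (kill_B u) =
  ap g u.
Proof.
move=> g0; rewrite /kill_B apB ap_sumr big_seq big1 ?subr0 // => i iB.
by rewrite g0 // mulr0.
Qed.

Lemma dual_B X f : dual_family v f (B `|` X) ->
  {in B &, forall i j, ap (f i) (v j) = (i == j)%:R}.
Proof. by move=> df i j iB jB; apply: df; rewrite in_fsetU ?iB ?jB. Qed.

Lemma dual_out X f e : [disjoint B & X]%fset -> dual_family v f (B `|` X) ->
  e \in X -> {in B, forall i, ap (f e) (v i) = 0}.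
Proof.
move=> dis df eX i iB; rewrite df ?in_fsetU ?iB ?eX ?orbT //.
by case: eqP => // ei; have := fdisjointP dis _ iB; rewrite -ei eX.
Qed.

Lemma dual_out_swap X f e : [disjoint B & X]%fset -> dual_family v f (B `|` X)
  ->
  e \in X -> {in B, forall i, ap (f i) (v e) = 0}.
Proof.
move=> dis df eX i iB; rewrite df ?in_fsetU ?iB ?eX ?orbT //.
by case: eqP => // ei; have := fdisjointP dis _ iB; rewrite ei eX.
Qed.

Lemma disB X : X `<=` C `|` D -> [disjoint B & X]%fset.
Proof. by move=> sX; apply: fdisjointWr disBC. Qed.

Lemma kill_B_comb (I : Type) (s : seq I) (k : I -> F) (g : I -> 'cV[F]_r) :
  kill_B (\sum_(e <- s) k e *: g e) = \sum_(e <- s) k e *: kill_B (g e).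
Proof.
rewrite /kill_B; under [RHS]eq_bigr do rewrite scalerBr.
rewrite sumrB; congr (_ - _); under [RHS]eq_bigr do rewrite scaler_sumr.
rewrite exchange_big /=; apply: eq_bigr => i _; rewrite ap_sumr scaler_suml.
by apply: eq_bigr => e _; rewrite scalerA.
Qed.

Lemma kill_B_combB (k : U -> F) : kill_B (\sum_(i <- B) k i *: v i) = 0.
Proof.
rewrite /kill_B; apply/eqP; rewrite subr_eq0; apply/eqP/eq_big_seq => i iB.
by rewrite (@dual_comb _ _ _ v f0 B k) //; apply: dual_B df0.
Qed.

(** When [f] is dual to [B] + X, this functional is 1 on column [c] and vanishes on the columns of
    X, so a nonzero value on column [d] puts that column outside their span. *)
Definition tester (f : U -> 'rV[F]_r) : 'rV[K]_(1 + r) :=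
  row_mx 1%:M (\sum_(i <- B) x i *: map_mx h (f i)).

Lemma tester_c f : ap (tester f) new_c = 1.
Proof. by rewrite ap_row_col ap0r addr0 mulr1. Qed.

(** The first row contributes the coordinates given by [f0] and the projection contributes the
    change from [f0] to [f], so that [f0] cancels. *)
Lemma tester_vec f e : {in B &, forall i j, ap (f i) (v j) = (i == j)%:R} ->
  ap (tester f) (new_vec e) = \sum_(i <- B) x i * h (ap (f i) (v e)).
Proof.
move=> df; rewrite ap_row_col mul1r ap_suml -big_split /=.
apply: eq_big_seq => i iB; rewrite ap_map ap_kill_B_in // -mulrDr -rmorphD /=.
by rewrite addrC subrK.
Qed.

Lemma tester_d f o : {in B &, forall i j, ap (f i) (v j) = (i == j)%:R} ->
  ap (tester f) (new_d o) = o + \sum_(j <- J) y j *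
     \sum_(i <- B) x i * h (ap (f i) (v j) - ap (f0 i) (v j)).
Proof.
move=> df; rewrite ap_row_col mul1r ap_sumr; congr (_ + _).
apply: eq_bigr => j _; congr (_ * _); rewrite ap_suml.
by apply: eq_big_seq => i iB; rewrite ap_map ap_kill_B_in.
Qed.

(* Contracting c in the new family is contracting B in the old one: the
   c-coordinate of K^(1+r) is the image of the span of B under x. *)
Lemma ffree_contract o X : X `<=` C `|` D ->
  ffree (new_family o) (c |` X) = ffree v (B `|` X).
Proof.
move=> sX; have cX : c \notin X by apply: contra c_new; apply: (fsubsetP sX).
have dis := disB sX.
apply/idP/idP=> [/ffreeP fW|/ffree_dual[f df]].
  apply/ffreeP=> k; rewrite big_fsetU_disjoint //= => s0.
  have kX : {in X, forall e, k e = 0}.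
    (* Projecting along [B] turns a relation on [B] and [X] into one on [X] alone. *)
    have p0 : \sum_(e <- X) k e *: kill_B (v e) = 0.
      have eX : \sum_(e <- X) k e *: v e = \sum_(i <- B) - k i *: v i.
        move/eqP: s0; rewrite addrC addr_eq0 => /eqP->; rewrite -sumrN.
        by apply: eq_bigr => i _; rewrite scaleNr.
      by rewrite -kill_B_comb eX kill_B_combB.
    pose a e := \sum_(i <- B) x i * h (ap (f0 i) (v e)).
    (* The coefficient at [c] is chosen to cancel the first row. *)
    pose k' e := if e == c then - \sum_(e <- X) h (k e) * a e else h (k e).
    have k'X e : e \in X -> k' e = h (k e).
      by rewrite /k'; case: eqP => // -> cX'; rewrite cX' in cX.
    have /fW k0 : \sum_(e <- c |` X) k' e *: new_family o e = 0.
      rewrite big_fsetU1 //= new_family_c /k' eqxx.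
      have -> : \sum_(e <- X) k' e *: new_family o e
          = col_mx (\sum_(e <- X) h (k e) * a e)%:M 0.
        transitivity (\sum_(e <- X) h (k e) *: new_vec e).
          by apply: eq_big_seq => e eX;
            rewrite k'X // new_familyE // (fsubsetP sX).
        rewrite comb_col; congr col_mx;
          rewrite -[RHS](map_mx0 h) -p0 map_mx_sum.
        by apply: eq_bigr => e _; rewrite map_mxZ.
      by rewrite /new_c scale_col_mx scalemx1 scaler0 add_col_mx addr0 -rmorphD
        /= addNr raddf0 col_mx0.
    move=> e eX; apply/eqP; rewrite -(fmorph_eq0 h) -k'X // k0 //.
    by rewrite in_fset1U eX orbT.
  move: s0; rewrite [X in _ + X]big_seq [X in _ + X]big1 ?addr0 => [s0|e eX];
    last first.
    by rewrite kX // scale0r.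
  have /ffreeP/(_ k s0) kB : ffree v B by apply: dual_ffree (dual_B df0).
  by move=> e; rewrite in_fsetU => /orP[/kB|/kX].
(* The dual family on the new side: [tester f] belongs to [c], and the functionals of [X] ignore the
   first row. *)
apply: (@dual_ffree _ _ _ _ (fun e => if e == c then tester f else row_mx 0%:M
  (map_mx h (f e)))).
move=> e e'; rewrite !in_fset1U.
have nXc z : z \in X -> (z == c) = false by apply: contraTF => /eqP->.
case/orP=> [/eqP->|eX]; case/orP=> [/eqP->|e'X].
- by rewrite eqxx new_family_c tester_c.
- rewrite eqxx (new_familyE o (fsubsetP sX _ e'X)) tester_vec;
    last exact: dual_B df.
  rewrite eq_sym nXc // big_seq big1 // => i iB.
  by rewrite (dual_out_swap dis df e'X iB) rmorph0 mulr0.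
- by rewrite nXc // new_family_c ap_row_col ap0r addr0 mul0r.
rewrite nXc // (new_familyE o (fsubsetP sX _ e'X)) ap_row_col mul0r add0r
  ap_map.
rewrite ap_kill_B_out ?df ?in_fsetU ?eX ?e'X ?orbT ?rmorph_nat //.
exact: dual_out df eX.
Qed.

Definition new_ground : {fset U} := c |` (d |` (C `|` D)).

Lemma v_fspan e : e \in C `|` D `|` J -> v e \in fspan v (B `|` C).
Proof.
rewrite -fsetUA in_fsetU => /orP[eC|/vBC//].
by apply: mem_fspan; rewrite in_fsetU eC orbT.
Qed.

Lemma subC_CD : C `<=` C `|` D. Proof. exact: fsubsetUl. Qed.

Lemma kill_B_C : {in C, forall s, kill_B (v s) = v s}.
Proof.
move=> s sC; rewrite /kill_B big_seq big1 ?subr0 // => i iB.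
by rewrite (dual_out_swap (disB subC_CD) df0 sC iB) scale0r.
Qed.

Lemma new_vec_C s : s \in C -> new_vec s = col_mx 0%:M (map_mx h (v s)).
Proof.
move=> sC; rewrite /new_vec kill_B_C // big_seq big1 // => i iB.
by rewrite (dual_out_swap (disB subC_CD) df0 sC iB) rmorph0 mulr0.
Qed.

Lemma kill_B_fspan e : v e \in fspan v (B `|` C) ->
  kill_B (v e) = \sum_(s <- C) ap (f0 s) (v e) *: v s.
Proof.
move=> ve; rewrite /kill_B {1}(dual_fspan df0 ve) big_fsetU_disjoint ?disB
  ?subC_CD //=.
by rewrite addrAC subrr add0r.
Qed.

(** The projection lies in the span of the vectors of [C], and the new columns of [C] have first row
    0. *)
Lemma col_kill_B_fspan o e : v e \in fspan v (B `|` C) ->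
  col_mx 0%:M (map_mx h (kill_B (v e))) \in fspan (new_family o) C.
Proof.
move=> /kill_B_fspan->.
have -> : col_mx 0%:M (map_mx h (\sum_(s <- C) ap (f0 s) (v e) *: v s))
    = \sum_(s <- C) h (ap (f0 s) (v e)) *: new_family o s.
  transitivity (\sum_(s <- C) h (ap (f0 s) (v e)) *: (col_mx 0%:M (map_mx h (v
    s)) : 'cV_(1 + r))).
    rewrite comb_col; congr (col_mx (_%:M) _);
      first by rewrite big1 // => s _; rewrite mulr0.
    by rewrite map_mx_sum; apply: eq_bigr => s _; rewrite map_mxZ.
  apply: eq_big_seq => s sC; rewrite -new_vec_C // new_familyE //.
  exact: (fsubsetP subC_CD).
exact: comb_fspan.
Qed.

Lemma col_split (a : K) (u : 'cV[K]_r) :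
  col_mx a%:M u = a *: new_c + col_mx 0%:M u.
Proof.
by rewrite /new_c scale_col_mx scalemx1 scaler0 add_col_mx -raddfD /= addr0
  add0r.
Qed.

(** This makes [d] + [C] dependent in the first matroid and puts [d] in the hyperplane spanned by
    [C]. *)
Lemma new_d_fspan o : new_d 0 \in fspan (new_family o) C.
Proof.
have -> : new_d 0 = \sum_(j <- J) y j *: (col_mx 0%:M (map_mx h (kill_B (v j)))
  : 'cV_(1 + r)).
  rewrite comb_col /new_d; congr (col_mx (_%:M) _).
  by rewrite big1 // => j _; rewrite mulr0.
rewrite big_seq; apply: rpred_sum => j jJ; apply: rpredZ;
  apply: col_kill_B_fspan.
by apply: v_fspan; rewrite in_fsetU jJ orbT.
Qed.

(** Together with [ffree_cC] this makes [c] + [C] a basis for either value of [o], so that both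
    ranks are |C| + 1. *)
Lemma new_family_fspan o e : e \in new_ground -> new_family o e \in fspan
  (new_family o) (c |` C).
Proof.
have wcS : new_c \in fspan (new_family o) (c |` C).
  by rewrite -(new_family_c o); apply: mem_fspan; rewrite fset1U1.
have sub := subvP (fspanS (new_family o) (fsubsetU1 c C)).
rewrite /new_ground !in_fset1U => /or3P[/eqP->|/eqP->|eCD];
  first by rewrite new_family_c.
  by rewrite new_family_d /new_d col_split rpredD ?rpredZ // sub // new_d_fspan.
rewrite new_familyE // /new_vec col_split rpredD ?rpredZ // sub //
  col_kill_B_fspan // v_fspan //.
by rewrite in_fsetU eCD.
Qed.

Lemma ffree_cC o : ffree (new_family o) (c |` C).
Proof. by rewrite ffree_contract ?subC_CD //; apply: dual_ffree df0. Qed.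

Lemma c_notin_C : c \notin C.
Proof. by apply: contra c_new; apply: (fsubsetP subC_CD). Qed.

Lemma d_notin_C : d \notin C.
Proof. by apply: contra d_new; apply: (fsubsetP subC_CD). Qed.

Lemma sub_cC_new : c |` C `<=` new_ground.
Proof.
by apply/fsubsetP=> e; rewrite !inE => /orP[->|->]; rewrite ?orbT.
Qed.

Lemma dim_new_ground o : \dim (fspan (new_family o) new_ground) = #|` C|.+1.
Proof.
have := ffree_cC o; rewrite ffreeE => /eqP;
  rewrite cardfsU1 c_notin_C (add1n #|` C|) => <-.
congr (\dim _); apply/eqP; rewrite eqEsubv (fspanS _ sub_cC_new) andbT.
by apply: fspan_sub => e; apply: new_family_fspan.
Qed.

Lemma ffree_C o : ffree (new_family o) C.
Proof. exact: ffree_sub (fsubsetU1 c C) (ffree_cC o). Qed.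

(* tester f spans the annihilator of the columns in X - d, so that X is free
   as soon as it does not vanish on the column d; for both choices of that
   column its value is a nontrivial combination of om and the x_i * y_j. *)
Lemma ffree_new_family X : X `<=` new_ground -> #|` X| = #|` C|.+1 -> X != d |`
  C ->
  ffree (new_family 0) X = ffree (new_family om) X.
Proof.
move=> sX cX nX; have eqW X' : d \notin X' -> {in X', new_family 0 =1
  new_family om}.
  move=> dX e eX; rewrite /new_family; case: ifP => // _; case: eqP => // ed.
  by rewrite -ed eX in dX.
have [dX|dX] := boolP (d \in X); last by apply: eq_in_ffree; apply: eqW.
pose X' := X `\ d; have dX' : d \notin X' by rewrite !inE eqxx.
have eqF : ffree (new_family 0) X' = ffree (new_family om) X' by apply:
  eq_in_ffree; apply: eqW.
have eqS : fspan (new_family 0) X' = fspan (new_family om) X' by apply: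
  eq_in_fspan; apply: eqW.
rewrite -(fsetD1K dX) -/X' !ffreeU1 // eqF eqS.
rewrite !new_family_d; have [fX'|] := boolP (ffree (new_family om) X');
  last by rewrite !andbF.
(* If the span contains column [c], adding a multiple of it to column [d] does not affect
   membership. *)
rewrite !andbT; have [cS|cS] := boolP (new_c \in fspan (new_family om) X').
  have -> : new_d om = om *: new_c + new_d 0 by rewrite /new_d col_split.
  by rewrite rpredDl // rpredZ.
have cX' : c \notin X' by apply: contra cS => /(mem_fspan (new_family om));
  rewrite new_family_c.
have sX' : X' `<=` C `|` D.
  apply/fsubsetP=> e eX'; have eX : e \in X by move: eX';
    rewrite !inE => /andP[].
  have := fsubsetP sX _ eX; rewrite /new_ground !in_fset1U => /or3P[/eqP
    ec|/eqP ed|//].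
    by rewrite -ec eX' in cX'.
  by rewrite -ed eX' in dX'.
have : ffree (new_family om) (c |` X') by rewrite ffreeU1 // new_family_c cS.
rewrite ffree_contract // => /ffree_dual[f df].
have cardX' : #|` X'| = #|` C| by move: cX; rewrite (cardfsD1 d) dX => -[].
have nX' : X' != C by apply: contraNneq nX => <-; rewrite fsetD1K.
have [i [j [iB jJ ne]]] := change sX' cardX' nX' df.
have dB := dual_B df.
have L0 : {in X', forall e, ap (tester f) (new_family om e) = 0}.
  move=> e eX'; rewrite new_familyE ?(fsubsetP sX') // tester_vec // big_seq
    big1 // => i' i'B.
  by rewrite (dual_out_swap (disB sX') df eX' i'B) rmorph0 mulr0.
(* Both columns are treated at once: t = 0 gives [new_d 0] and t = 1 gives [new_d om]. *)
have nin o t : o = om * h t -> new_d o \notin fspan (new_family om) X'.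
  move=> eo; apply/negP=> /(ap_fspan0 L0); rewrite (tester_d _ dB) addrC eo.
  move/(@indep_yx (fun i j => ap (f i) (v j) - ap (f0 i) (v j)))/(_ _ _ iB
    jJ)/eqP.
  by rewrite subr_eq0 (negPf ne).
by rewrite (nin 0 0) ?(nin om 1) ?rmorph1 ?rmorph0 ?mulr1 ?mulr0.
Qed.

(** For X = C the differences Z vanish, so [tester f0] takes the nonzero value [om] on column [d]
    and 0 on the columns of [C]. *)
Lemma ffree_relaxed : ffree (new_family om) (d |` C).
Proof.
rewrite ffreeU1 ?d_notin_C // ffree_C andbT new_family_d; apply/negP.
have dB := dual_B df0; move/(@ap_fspan0 _ _ _ _ (tester f0));
  rewrite tester_d // big1 ?addr0.
  move=> h0; move/eqP: nz_om; apply; apply: h0 => e eC.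
  rewrite new_familyE ?(fsubsetP subC_CD) // tester_vec // big_seq big1 // => i
    iB.
  by rewrite (dual_out_swap (disB subC_CD) df0 eC iB) rmorph0 mulr0.
by move=> j _; rewrite big1 ?mulr0 // => i _; rewrite subrr rmorph0 mulr0.
Qed.

Lemma fspan_circuit : fspan (new_family 0) (d |` C) = fspan (new_family 0) C.
Proof.
rewrite fspanU fspan1 new_family_d; apply/addv_idPr.
by rewrite -memvE; apply: new_d_fspan.
Qed.

Lemma circuit_not_ffree : ~~ ffree (new_family 0) (d |` C).
Proof. by rewrite ffreeU1 ?d_notin_C // new_family_d new_d_fspan. Qed.

(** The functional [f0 z] kills the rest of [C]; on column [d] it is a combination of the y_j that
    [nzC] and the independence of the y_j keep nonzero. *)
Lemma ffree_circuit_sub z : z \in C -> ffree (new_family 0) (d |` (C `\ z)).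
Proof.
move=> zC; have dC : d \notin C `\ z by rewrite in_fsetD1 (negPf d_notin_C)
  andbF.
rewrite ffreeU1 // (ffree_sub (fsubsetDl _ _) (ffree_C 0)) andbT new_family_d;
  apply/negP.
move/(@ap_fspan0 _ _ _ _ (row_mx 0%:M (map_mx h (f0 z)))).
have z0 := dual_out (disB subC_CD) df0 zC.
rewrite ap_row_col mul0r add0r ap_sumr.
under eq_bigr do rewrite ap_map (ap_kill_B_out _ z0).
have [j jJ /eqP nz] := nzC zC; move=> s0; apply: nz.
apply: (indep_y (z := fun j => ap (f0 z) (v j))) => //; apply: s0 => e.
rewrite in_fsetD1 => /andP[ez eC];
  rewrite new_familyE ?(fsubsetP subC_CD) // new_vec_C //.
rewrite ap_row_col mul0r add0r ap_map df0 ?in_fsetU ?zC ?eC ?orbT //.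
by rewrite eq_sym (negPf ez) rmorph0.
Qed.

(** The first row vanishes on [C]; at [e] it is a combination of the x_i that [nzD] and the
    independence of the x_i keep nonzero. *)
Lemma ffree_off_hyperplane e : e \in D -> ffree (new_family 0) (e |` C).
Proof.
move=> eD; have eC : e \notin C.
  by apply/negP=> /(fdisjointP disCD); rewrite eD.
rewrite ffreeU1 // ffree_C andbT; apply/negP.
move/(@ap_fspan0 _ _ _ _ (row_mx 1%:M 0)).
rewrite new_familyE ?in_fsetU ?eD ?orbT // ap_row_col mul1r /ap mul0mx mxE
  addr0.
have [i iB /eqP nz] := nzD eD; move=> s0; apply: nz.
apply: (indep_x (z := fun i => ap (f0 i) (v e))) => //; apply: s0 => s sC.
by rewrite new_familyE ?(fsubsetP subC_CD) // new_vec_C // -/(ap _ _)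
  ap_row_col mul1r /ap mul0mx mxE addr0.
Qed.

Lemma relaxation_new_family :
  relaxation_at (vec_matroid (new_family 0) new_ground) (d |` C) (vec_matroid
    (new_family om) new_ground).
Proof.
have sH : d |` C `<=` new_ground.
  by apply/fsubsetP=> e; rewrite !inE => /orP[->|->]; rewrite ?orbT.
have rep o := @vec_matroid_independent _ _ _ (new_family o) new_ground.
have rk X : X `<=` new_ground ->
    rank (vec_matroid (new_family 0) new_ground) X = \dim (fspan (new_family 0)
      X).
  by move=> sX; apply: rank_fspan => // Y sY; apply: rep.
have dimC : \dim (fspan (new_family 0) C) = #|` C|.
  by apply/eqP; rewrite -ffreeE ffree_C.
split=> //.
- split=> //; first by rewrite rep // circuit_not_ffree.
  move=> Y; rewrite fproperE => /andP[sY /fsubsetPn[z zH zY]].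
  rewrite rep ?(fsubset_trans sY) //.
  move: zH; rewrite in_fset1U => /orP[/eqP ez|zC].
    apply: ffree_sub (ffree_C 0); apply/fsubsetP=> e eY.
    have := fsubsetP sY _ eY; rewrite in_fset1U => /orP[/eqP ed|//].
    by rewrite ez -ed eY in zY.
  apply: ffree_sub (ffree_circuit_sub zC); apply/fsubsetP=> e eY.
  have := fsubsetP sY _ eY; rewrite !inE => /orP[->//|->]; rewrite andbT.
  by rewrite (contraNneq _ zY) ?orbT // => <-.
- split; last first.
    by rewrite !rk //= fspan_circuit dimC dim_new_ground.
  split=> // e; rewrite in_fsetD => /andP[eH eE].
  have sEH : e |` (d |` C) `<=` new_ground by rewrite fsubUset fsub1set eE.
  rewrite !rk // fspan_circuit dimC.
  (* Off the hyperplane, [e] is [c] or lies in [D]. *)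
  have : ffree (new_family 0) (e |` C).
    move: eE eH; rewrite !in_fset1U in_fsetU =>
      /or4P[/eqP->|->//|->|/ffree_off_hyperplane//].
      by rewrite ffree_cC.
    by rewrite orbT.
  rewrite ffreeE => /eqP eqd eqC.
  have : (\dim (fspan (new_family 0) (e |` C)) <= \dim (fspan (new_family 0) (e
    |` (d |` C))))%N.
    by apply/dimvS/fspanS/fsetUS/fsubsetU1.
  rewrite eqC eqd cardfsU1.
  by move: eH; rewrite in_fset1U negb_or => /andP[_ ->];
    rewrite (add1n #|` C|) ltnn.
(* Only [d] + [C] changes status: [ffree_new_family] covers all other sets of basis size. *)
apply/fsetP=> X; rewrite in_fset1U; have [->|nX] := eqVneq X (d |` C).
  apply/vec_basesP; split=> //; first exact: ffree_relaxed.
  by rewrite dim_new_ground cardfsU1 d_notin_C.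
apply/vec_basesP/vec_basesP; rewrite !dim_new_ground => -[sX fX cX]; split=> //.
  by rewrite ffree_new_family.
by rewrite -ffree_new_family.
Qed.

End Construction.

(** * Consequences of fragility for a representation of [M] *)

Section FragileVectors.
Import GRing.Theory.
Local Open Scope ring_scope.

Lemma dim_fspanU1 (U : choiceType) (F : fieldType) (vT : vectType F)
    (v : U -> vT) (e : U) (X : {fset U}) :
  v e \notin fspan v X -> \dim (fspan v (e |` X)) = (\dim (fspan v X)).+1.
Proof.
move=> eX; have [Y [_ sY fY cY]] := ffree_extend (fsub0set X) (ffree0 v).
have eS : fspan v Y = fspan v X.
  apply/eqP; rewrite eqEdim fspanS //= -cY.
  by move: fY; rewrite ffreeE => /eqP->; rewrite leqnn.
have eY : e \notin Y by apply: contra eX => /(mem_fspan v); rewrite eS.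
have : ffree v (e |` Y) by rewrite ffreeU1 // eS eX.
by rewrite ffreeE cardfsU1 eY cY fspanU eS -fspanU => /eqP.
Qed.

(* Modulo the span of S, a vector of the span of B and S is determined by its
   B-coordinates. *)
Lemma ffree_dualU (U : choiceType) (F : fieldType) (r : nat) (v : U -> 'cV[F]_r)
    (f : U -> 'rV[F]_r) (B S X : {fset U}) :
  [disjoint B & S]%fset -> [disjoint X & S]%fset -> dual_family v f (B `|` S) ->
  {in X, forall x, v x \in fspan v (B `|` S)} ->
  ffree v (X `|` S) <->
  (forall k, {in B, forall i, \sum_(x <- X) k x * ap (f i) (v x) = 0} ->
     {in X, forall x, k x = 0}).
Proof.
move=> dBS dXS df sX; split=> [/ffreeP fX k k0 x xX|fX].
  pose u := \sum_(x <- X) k x *: v x.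
  have uS : u \in fspan v (B `|` S).
    by rewrite /u big_seq; apply: rpred_sum => z zX; apply/rpredZ/sX.
  have uE : u = \sum_(s <- S) ap (f s) u *: v s.
    rewrite {1}(dual_fspan df uS) big_fsetU_disjoint //=.
    rewrite big_seq big1 ?add0r // => i iB.
    by rewrite /u ap_sumr k0 // scale0r.
  have xS := fdisjointP dXS _ xX.
  (* Since [u] lies in the span of [S], its negated coordinates complete [k] to a relation on [X]
     and [S]. *)
  pose k' z := if z \in S then - ap (f z) u else k z.
  have : k' x = 0.
    apply: fX; rewrite ?in_fsetU ?xX // big_fsetU_disjoint //=.
    have -> : \sum_(z <- X) k' z *: v z = u.
      by apply: eq_big_seq => z zX; rewrite /k' (negPf (fdisjointP dXS _ zX)).
    rewrite {1}uE -big_split big_seq big1 //= => z zS.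
    by rewrite /k' zS scaleNr subrr.
  by rewrite /k' (negPf xS).
apply/ffreeP=> k; rewrite big_fsetU_disjoint //= => s0.
have kX : {in X, forall x, k x = 0}.
  apply: fX => i iB; rewrite -ap_sumr.
  move/eqP: s0; rewrite addr_eq0 => /eqP->; rewrite -sumrN.
  under eq_bigr do rewrite -scaleNr.
  rewrite ap_sumr big_seq big1 // => s sS.
  rewrite df ?in_fsetU ?iB ?sS ?orbT //.
  case: eqP => [si|]; last by rewrite mulr0.
  by have := fdisjointP dBS _ iB; rewrite si sS.
move: s0; rewrite big_seq big1 ?add0r => [s0|x xX];
  last by rewrite kX // scale0r.
have /ffreeP/(_ k s0) kS : ffree v S.
  by apply: ffree_sub (dual_ffree df); apply: fsubsetUr.
by move=> x; rewrite in_fsetU => /orP[/kX|/kS].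
Qed.

Lemma dim_ffreeU (U : choiceType) (F : fieldType) (vT : vectType F)
    (v : U -> vT) (X S : {fset U}) : [disjoint X & S]%fset -> ffree v S ->
  (\dim (fspan v (X `|` S)) == #|` X| + \dim (fspan v S))%N = ffree v (X `|` S).
Proof.
move=> dXS; rewrite !ffreeE => /eqP->; rewrite cardfsU.
by move: dXS; rewrite -fsetI_eq0 => /eqP->; rewrite cardfs0 subn0.
Qed.

Variables (U : choiceType) (F : fieldType) (r : nat) (v : U -> 'cV[F]_r).
Variables (N M : matroid U) (B C D : {fset U}).
Hypothesis NB : B \in bases N.
Hypothesis rep : forall X, X `<=` ground M -> independent M X = ffree v X.
Hypothesis MN : fragile N M.
Hypothesis disCD : [disjoint C & D]%fset.
Hypothesis eU : C `|` D = ground M `\` ground N.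
Hypothesis eN : N = deletion (contraction M C) D.

Let J := ground N `\` B.

Let sNM : ground N `<=` ground M. Proof. by case: MN => [[]]. Qed.
Let sBN : B `<=` ground N. Proof. exact: base_sub. Qed.
Let sCDM : C `|` D `<=` ground M. Proof. by rewrite eU fsubsetDl. Qed.
Let sCD : C `<=` C `|` D. Proof. exact: fsubsetUl. Qed.
Let gN : ground N = ground M `\` C `\` D.
Proof. by rewrite fsetDDl eU fsetDK. Qed.
Let disN X : X `<=` ground N -> [disjoint X & C `|` D]%fset.
Proof.
move=> sX; apply/fdisjointP=> z zX; rewrite eU !inE.
by rewrite (fsubsetP sX _ zX).
Qed.
Let disNS X S : X `<=` ground N -> S `<=` C `|` D -> [disjoint X & S]%fset.
Proof. by move=> /disN dX sS; apply: fdisjointWr dX. Qed.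
Let sM X S : X `<=` ground N -> S `<=` C `|` D -> X `|` S `<=` ground M.
Proof.
move=> sX sS; rewrite fsubUset (fsubset_trans sX sNM).
exact: fsubset_trans sS sCDM.
Qed.

(** Fragility in terms of dimensions. Each structural property of the representation below comes
    from offering a competitor of [C] here. *)
Lemma fragile_vectors_unique C' : C' `<=` C `|` D ->
  (forall X, X `<=` ground N ->
     (\dim (fspan v (X `|` C)) == #|` X| + \dim (fspan v C))%N
     = (\dim (fspan v (X `|` C')) == #|` X| + \dim (fspan v C'))%N) -> C' = C.
Proof.
move=> sC' eI; apply: (fragile_unique MN disCD eU eN sC') => X sX.
have rk := rank_fspan rep; rewrite !rk ?sM // ?(fsubset_trans _ sCDM) //.
exact: eI.
Qed.

(** A maximal free subset of [C] has the same span, hence competes with [C] and equals it. *)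
Lemma fragile_ffree_C : ffree v C.
Proof.
have [Y [_ sY fY cY]] := ffree_extend (fsub0set C) (ffree0 v).
suff <- : Y = C by [].
have eS : fspan v Y = fspan v C.
  apply/eqP; rewrite eqEdim fspanS //= -cY.
  by move: fY; rewrite ffreeE => /eqP->; rewrite leqnn.
apply: fragile_vectors_unique => [|X _]; first exact: fsubset_trans sY sCD.
by rewrite !fspanU eS.
Qed.

Lemma fragile_independent X : X `<=` ground N ->
  independent N X = ffree v (X `|` C).
Proof.
move=> sX; have sC := fsubset_trans sCD sCDM.
have /(minorP sC gN) -> := eN;
  rewrite // -dim_ffreeU ?fragile_ffree_C ?disNS //.
by rewrite !(rank_fspan rep) ?sM.
Qed.

Lemma fragile_ffree_BC : ffree v (B `|` C).
Proof. by rewrite -fragile_independent // base_independent. Qed.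

Lemma fragile_fspan_N e : e \in ground N -> v e \in fspan v (B `|` C).
Proof.
move=> eNg; have [eB|eB] := boolP (e \in B).
  by apply: mem_fspan; rewrite in_fsetU eB.
apply/negPn/negP=> ve.
have eBC : e \notin B `|` C by apply: contra ve; apply: mem_fspan.
have seB : e |` B `<=` ground N by rewrite fsubUset fsub1set eNg.
have : independent N (e |` B).
  by rewrite fragile_independent // -fsetUA ffreeU1 // ve fragile_ffree_BC.
case/hasP=> B2 B2b /fsubset_leq_card.
by rewrite (eq_card_bases (bases_exchange N) B2b NB) cardfsU1 eB ltnn.
Qed.

(** An element of [C] + [D] outside this span could be added to [C]: both sides of the dimension
    condition would grow by one. *)
Lemma fragile_fspan e : e \in ground M -> v e \in fspan v (B `|` C).
Proof.
move=> eM; have [/fragile_fspan_N//|eNg] := boolP (e \in ground N).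
have eCD : e \in C `|` D by rewrite eU !inE eNg.
apply/negPn/negP=> ve; have sX X : X `<=` ground N -> v e \notin fspan v (X `|`
  C).
  move=> sX; apply: contra ve; apply/subvP/fspan_sub => z.
  rewrite in_fsetU => /orP[/(fsubsetP sX)/fragile_fspan_N//|zC].
  by apply: mem_fspan; rewrite in_fsetU zC orbT.
have : e |` C = C.
  apply: fragile_vectors_unique => [|X /sX veX].
    by rewrite fsubUset fsub1set eCD.
  rewrite fsetUCA !dim_fspanU1 //; first by rewrite addnS eqSS.
  by have := sX _ (fsub0set _); rewrite fset0U.
move/fsetP/(_ e); rewrite fset1U1 => /esym eC.
by move/negP: ve; apply; apply: mem_fspan; rewrite in_fsetU eC orbT.
Qed.

Variable f0 : U -> 'rV[F]_r.
Hypothesis df0 : dual_family v f0 (B `|` C).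

Let disBC : [disjoint B & C]%fset. Proof. exact: disNS. Qed.

(** Otherwise [f0 e] vanishes on all of [ground N] and on [C] without [e], so that removing [e] from
    [C] lowers both sides of the dimension condition by one. *)
Lemma fragile_nzC : {in C, forall e, exists2 j, j \in J & ap (f0 e) (v j) != 0}.
Proof.
move=> e eC; apply/hasP; apply/negPn/negP=> /hasPn e0.
have fe0 : {in ground N, forall z, ap (f0 e) (v z) = 0}.
  move=> z zN; have [zB|zB] := boolP (z \in B); last first.
    by apply/eqP/negPn/e0; rewrite in_fsetD zB.
  rewrite df0 ?in_fsetU ?zB ?eC ?orbT //; case: eqP => // ez.
  by have := fdisjointP disBC _ zB; rewrite -ez eC.
have sX X : X `<=` ground N -> v e \notin fspan v (X `|` (C `\ e)).
  move=> sX; apply/negP=> /(@ap_fspan0 _ _ _ _ (f0 e)) h.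
  have : ap (f0 e) (v e) = 0.
    apply: h => z; rewrite in_fsetU => /orP[/(fsubsetP sX)/fe0//|].
    rewrite in_fsetD1 => /andP[ze zC]; rewrite df0 ?in_fsetU ?eC ?zC ?orbT //.
    by rewrite eq_sym (negPf ze).
  by move/eqP; rewrite df0 ?in_fsetU ?eC ?orbT // eqxx oner_eq0.
have : C `\ e = C.
  apply: fragile_vectors_unique => [|X /sX veX].
    exact: fsubset_trans (fsubsetDl _ _) sCD.
  rewrite -{1 2}(fsetD1K eC) fsetUCA !dim_fspanU1 //;
    first by rewrite addnS eqSS.
  by have := sX _ (fsub0set _); rewrite fset0U.
by move/fsetP/(_ e); rewrite in_fsetD1 eqxx eC.
Qed.

(** Otherwise [v e] lies in the span of [C], and adding [e] to [C] changes no span. *)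
Lemma fragile_nzD : {in D, forall e, exists2 i, i \in B & ap (f0 i) (v e) != 0}.
Proof.
move=> e eD; apply/hasP; apply/negPn/negP=> /hasPn e0.
have eCD : e \in C `|` D by rewrite in_fsetU eD orbT.
have veC : v e \in fspan v C.
  rewrite (dual_fspan df0 (fragile_fspan (fsubsetP sCDM _ eCD))).
  rewrite big_fsetU_disjoint //= big_seq big1 ?add0r; first exact: comb_fspan.
  by move=> i iB; have /negPn/eqP-> := e0 _ iB; rewrite scale0r.
have eS : fspan v (e |` C) = fspan v C.
  by rewrite fspanU fspan1; apply/addv_idPr; rewrite -memvE.
have : e |` C = C.
  apply: fragile_vectors_unique => [|X sX].
    by rewrite fsubUset fsub1set eCD.
  by rewrite !(fspanU v X) eS.
move/fsetP/(_ e); rewrite fset1U1 => /esym/(fdisjointP disCD).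
by rewrite eD.
Qed.

(** If all [B]-coordinates of [ground N] agreed, the criterion [ffree_dualU] would be the same
    modulo [X] and modulo [C], making [X] a competitor of [C]. *)
Lemma fragile_change X f : X `<=` C `|` D -> #|` X| = #|` C| -> X != C ->
  dual_family v f (B `|` X) ->
  exists i j, [/\ i \in B, j \in J & ap (f i) (v j) != ap (f0 i) (v j)].
Proof.
move=> sX cX nX df.
suff /hasP[i iB /hasP[j jJ ne]] :
    has (fun i => has (fun j => ap (f i) (v j) != ap (f0 i) (v j)) J) B.
  by exists i, j.
apply/negPn/negP=> /hasPn e0.
have eqf : {in B & ground N, forall i z, ap (f i) (v z) = ap (f0 i) (v z)}.
  move=> i z iB zN; have [zB|zB] := boolP (z \in B).
    by rewrite df ?df0 // in_fsetU ?iB ?zB.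
  apply/eqP/negPn; have /hasPn := e0 _ iB; apply.
  by rewrite in_fsetD zB.
have dBX := disNS sBN sX.
(* Everything lies in the span of [B] and [C], and [B] + [X] is free of the same size. *)
have eS : fspan v (B `|` X) = fspan v (B `|` C).
  apply/eqP; rewrite eqEdim; apply/andP; split.
    by apply: fspan_sub => z zX; apply: fragile_fspan; apply: fsubsetP zX;
      apply: sM.
  have := dual_ffree df; have := dual_ffree df0;
    rewrite !ffreeE => /eqP-> /eqP->.
  rewrite !cardfsU cX.
  by move: dBX disBC; rewrite -!fsetI_eq0 => /eqP-> /eqP->.
move/eqP: nX; apply; apply: fragile_vectors_unique => // Y sY.
rewrite !dim_ffreeU ?disNS ?fragile_ffree_C //; last first.
  by apply: ffree_sub (dual_ffree df); apply: fsubsetUr.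
have sYC : {in Y, forall x, v x \in fspan v (B `|` C)}.
  by move=> z /(fsubsetP sY); apply: fragile_fspan_N.
have sYX : {in Y, forall x, v x \in fspan v (B `|` X)} by rewrite eS.
apply/idP/idP.
  move/(ffree_dualU disBC (disNS sY sCD) df0 sYC) => h.
  apply/(ffree_dualU dBX (disNS sY sX) df sYX) => k k0; apply: h => i iB.
  rewrite -[RHS](k0 i iB); apply: eq_big_seq => z zY.
  by rewrite eqf // (fsubsetP sY).
move/(ffree_dualU dBX (disNS sY sX) df sYX) => h.
apply/(ffree_dualU disBC (disNS sY sCD) df0 sYC) => k k0; apply: h => i iB.
rewrite -[RHS](k0 i iB); apply: eq_big_seq => z zY.
by rewrite eqf // (fsubsetP sY).
Qed.

End FragileVectors.

(** * Finite fields: generators, embeddings and independent powers *)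

Section FiniteFields.
Import GRing.Theory.
Local Open Scope ring_scope.

Lemma finField_generator (F : finFieldType) :
  exists2 a : F, a != 0 & forall y, y != 0 -> exists i, y = a ^+ i.
Proof.
have /cyclicP[u Du] := field_unit_group_cyclic [set: {unit F}]%G.
exists (val u) => [|y nz_y]; first by rewrite -unitfE (valP u).
have : finField_unit nz_y \in <[u]>%g by rewrite -Du inE.
case/cycleP=> i /(congr1 val) /= ->; exists i.
exact: FinRing.val_unitX.
Qed.

(* If a nonzero polynomial of degree s < n vanished at t, every element of K,
   being 0 or a power of t, would be a value at t of a remainder mod p, so that
   K would have at most #|F| ^ s elements. *)
Lemma generator_not_root (F K : finFieldType) (f : {rmorphism F -> K}) (n : nat)
    (t : K) (p : {poly F}) :
  #|K| = (#|F| ^ n)%N -> (forall y, y != 0 -> exists i, y = t ^+ i) ->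
  (size p <= n)%N -> (map_poly f p).[t] = 0 -> p = 0.
Proof.
move=> cardK gen le_pn pt0; apply/eqP/negPn/negP=> nz_p.
pose s := (size p).-1; have s_p : (s.+1 = size p)%N.
  by rewrite prednK // lt0n size_poly_eq0.
pose h (r : 'rV[F]_s) : K := (map_poly f (rVpoly r)).[t].
have h_onto y : exists r, y = h r.
  suff [q ->] : exists q : {poly F}, y = (map_poly f q).[t].
    exists (poly_rV (q %% p)); rewrite /h poly_rV_K; last first.
      by rewrite -ltnS s_p ltn_modp.
    rewrite {1}(divp_eq q p) rmorphD rmorphM /= hornerD hornerM pt0.
    by rewrite mulr0 add0r.
  have [->|/gen[i ->]] := eqVneq y 0; first by exists 0;
    rewrite rmorph0 horner0.
  by exists 'X^i; rewrite map_polyXn hornerXn.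
have : (#|K| <= #|'rV[F]_s|)%N.
  rewrite -(cardsT 'rV[F]_s); apply: leq_trans (leq_imset_card h setT).
  apply: subset_leq_card; apply/subsetP=> y _.
  by have [r ->] := h_onto y; apply: imset_f.
rewrite card_mx mul1n cardK leq_exp2l ?finNzRing_gt1 // => le_ns.
by move: (leq_trans le_pn le_ns); rewrite -s_p ltnn.
Qed.

Lemma pchar_embedding (R : nzRingType) (p : nat) :
  p \in [pchar R] -> inhabited {rmorphism 'F_p -> R}.
Proof.
move=> Rp; constructor.
exact: (GRing.in_alg (pPrimeCharType Rp) : {rmorphism 'F_p -> pPrimeCharType
  Rp}).
Qed.

(** If [a] generates [F], a polynomial [mu] of least size over the prime field vanishing at [a]
    divides X^|F| - X, hence X^|K| - X, which splits over [K]. A root [b] of [mu] in [K] gives the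
    map sending q(a) to q(b). *)
Lemma finField_embedding (F K : finFieldType) (n : nat) :
  #|K| = (#|F| ^ n)%N -> inhabited {rmorphism F -> K}.
Proof.
move=> cardK; have [p p_pr Fp] := finPcharP F.
have [m cardF] : exists m, #|F| = (p ^ m)%N.
  by exists (logn p #|F|); apply: (card_pprimeChar Fp).
have Kp : p \in [pchar K].
  by apply: (@card_finPcharP _ p (m * n)) => //; rewrite cardK cardF expnM.
have [iF] := pchar_embedding Fp; have [iK] := pchar_embedding Kp.
have [a _ gen_a] := finField_generator F.
pose g : {poly 'F_p} := 'X^#|F| - 'X.
have size_g (R : nzRingType) k : (1 < k)%N -> size ('X^k - 'X : {poly R}) =
  k.+1.
  by move=> k1; rewrite size_polyDl size_polyXn // size_polyN size_polyX.
have ga : (map_poly iF g).[a] = 0.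
  rewrite rmorphB /= map_polyXn map_polyX hornerD hornerN hornerXn hornerX.
  by rewrite expf_card subrr.
have nz_g : g != 0 by rewrite -size_poly_eq0 size_g ?finNzRing_gt1.
(* Polynomials of size at most [d] are coded by rows, so that existence is decidable and a least [d]
   can be taken. *)
have ex_d : exists d, [exists r : 'rV['F_p]_d,
    (rVpoly r != 0) && ((map_poly iF (rVpoly r)).[a] == 0)].
  exists (size g); apply/existsP; exists (poly_rV g).
  by rewrite poly_rV_K // nz_g ga eqxx.
case: (ex_minnP ex_d) => d /existsP[r /andP[]].
move: (size_poly d (fun k => oapp (r 0) 0 (insub k))); rewrite -/(rVpoly r).
move: (rVpoly r) => mu le_mu_d nz_mu /eqP mua min_d.
have mu_dvd q : (map_poly iF q).[a] = 0 -> mu %| q.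
  move=> qa; rewrite /dvdp; apply/negPn/negP=> nz.
  have: (d <= size (q %% mu)%R)%N.
    apply: min_d; apply/existsP; exists (poly_rV (q %% mu)).
    rewrite poly_rV_K // nz; move: qa;
      rewrite {1}(divp_eq q mu) rmorphD rmorphM /=.
    by rewrite hornerD hornerM mua mulr0 add0r => ->.
  by rewrite leqNgt (leq_trans (ltn_modpN0 _ nz_mu)).
have : map_poly iK mu %| \prod_(x : K) ('X - x%:P).
  rewrite -finField_genPoly cardK.
  have dvd_g : map_poly iK mu %| 'X^#|F| - 'X.
    have -> : 'X^#|F| - 'X = map_poly iK g.
      by rewrite rmorphB /= map_polyXn map_polyX.
    by rewrite dvdp_map mu_dvd.
  (* With Y = X^(|F|^k), write Y^|F| - X as Y^|F| - X^|F| plus X^|F| - X; the first difference is a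
     multiple of Y - X. *)
  elim: (n) => [|k IHk]; first by rewrite expn0 subrr dvdp0.
  rewrite expnSr exprM -(subrK ('X^#|F|) (('X^_ ^+ _)%R)) -addrA dvdp_add //.
  by rewrite subrXX dvdp_mulr.
(* A divisor of the split product is associate to a subproduct; the empty one would make [mu] a
   nonzero constant. *)
case/dvdp_prod_XsubC=> m0; case: (mask m0 _) => [|b l]; rewrite ?big_nil.
  move=> /eqp_size; rewrite size_map_poly size_poly1 => /eqP/size_poly1P[z nz_z
    e].
  by move: mua; rewrite e map_polyC hornerC => /eqP;
    rewrite fmorph_eq0 (negPf nz_z).
rewrite big_cons => /eqp_root/(_ b); rewrite rootM root_XsubC eqxx => /eqP mub.
have dvd_b q : (map_poly iF q).[a] = 0 -> (map_poly iK q).[b] = 0.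
  by case/mu_dvd/dvdpP=> z ->; rewrite rmorphM /= hornerM mub mulr0.
have ex_q x : exists q : {poly 'F_p}, x == (map_poly iF q).[a].
  have [->|/gen_a[i ->]] := eqVneq x 0; first by exists 0;
    rewrite rmorph0 horner0.
  by exists 'X^i; rewrite map_polyXn hornerXn.
(* The choice of [Q x] is immaterial: polynomials that agree at [a] differ by a multiple of [mu]. *)
pose Q x := xchoose (ex_q x); pose h x : K := (map_poly iK (Q x)).[b].
have hE q : h (map_poly iF q).[a] = (map_poly iK q).[b].
  apply/eqP; rewrite -subr_eq0 -hornerN -hornerD -rmorphB /=; apply/eqP/dvd_b.
  by rewrite rmorphB hornerD hornerN -(eqP (xchooseP (ex_q _))) subrr.
have hD : zmod_morphism h.
  move=> x y; rewrite {1}(eqP (xchooseP (ex_q x))) {1}(eqP (xchooseP (ex_q y))).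
  by rewrite -hornerN -hornerD -rmorphB /= hE rmorphB hornerD hornerN.
have hM : monoid_morphism h.
  split=> [|x y].
    have -> : 1 = (map_poly iF 1).[a] by rewrite rmorph1 hornerC.
    by rewrite hE rmorph1 hornerC.
  rewrite {1}(eqP (xchooseP (ex_q x))) {1}(eqP (xchooseP (ex_q y))).
  by rewrite -hornerM -rmorphM /= hE rmorphM hornerM.
pose hA := GRing.isZmodMorphism.Build F K h hD.
pose hR := GRing.isMonoidMorphism.Build F K h hM.
by exists; exact: (HB.pack_for {rmorphism F -> K} h hA hR).
Qed.
(** The sum is the value at [t] of a polynomial of size at most [n], which is therefore zero;
    distinct exponents isolate its coefficients. The exponent [m] is set aside for [om]. *)
Lemma powers_combination0 (F K : finFieldType) (f : {rmorphism F -> K}) (n :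
  nat)
    (t : K) (T : eqType) (S : seq T) (e : T -> nat) (z : T -> F) (m : nat) (y :
      F) :
  #|K| = (#|F| ^ n)%N -> (forall y, y != 0 -> exists i, y = t ^+ i) ->
  uniq S -> {in S &, injective e} -> {in S, forall s, e s < n}%N -> (m < n)%N ->
  {in S, forall s, e s != m} ->
  \sum_(s <- S) t ^+ e s * f (z s) + t ^+ m * f y = 0 ->
  {in S, forall s, z s = 0}.
Proof.
move=> cardK gen_t uS inj_e lt_e lt_m ne_m sum0 s sS.
pose p : {poly F} := \sum_(s <- S) z s *: 'X^(e s) + y *: 'X^m.
have p0 : p = 0.
  apply: (@generator_not_root _ _ f _ _ _ cardK gen_t).
    apply: leq_trans (size_polyD _ _) _; rewrite geq_max.
    rewrite (leq_trans (size_scale_leq _ _)) ?size_polyXn ?andbT //.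
    apply: leq_trans (size_sum _ _ _) _; apply/bigmax_leqP_seq=> u uS' _.
    by rewrite (leq_trans (size_scale_leq _ _)) ?size_polyXn ?lt_e.
  rewrite /p rmorphD rmorph_sum hornerD horner_sum -[RHS]sum0; congr (_ + _).
    apply: eq_bigr => u _.
    by rewrite /= map_polyZ map_polyXn hornerZ hornerXn mulrC.
  by rewrite /= map_polyZ map_polyXn hornerZ hornerXn mulrC.
have : p`_(e s) = 0 by rewrite p0 coef0.
rewrite coefD coef_sum coefZ coefXn (negPf (ne_m s sS)) mulr0 addr0.
rewrite (bigD1_seq s) //= coefZ coefXn eqxx mulr1 big_seq_cond big1 ?addr0 //.
move=> u /andP[uS' ne_us]; rewrite coefZ coefXn (inj_in_eq inj_e) // eq_sym.
by rewrite (negPf ne_us) mulr0.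
Qed.
End FiniteFields.

(** * The choice of the scalars x_i, y_j and [om] *)

Section GenericScalars.
Import GRing.Theory.
Local Open Scope ring_scope.

Lemma generic_scalars (T : choiceType) (F K : finFieldType)
    (h : {rmorphism F -> K}) (E B J : {fset T}) :
  (0 < #|` E|)%N -> #|K| = (#|F| ^ (2 * #|` E| ^ 2))%N ->
  B `<=` E -> J `<=` E ->
  exists (x y : T -> K) (om : K),
    [/\ om != 0,
        forall z : T -> F, \sum_(i <- B) x i * h (z i) = 0 ->
          {in B, forall i, z i = 0},
        forall z : T -> F, \sum_(j <- J) y j * h (z j) = 0 ->
          {in J, forall j, z j = 0}
      & forall (z : T -> T -> F) (a : F),
          \sum_(j <- J) y j * (\sum_(i <- B) x i * h (z i j)) + om * h a = 0 ->
          {in B & J, forall i j, z i j = 0}].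
Proof.
set k := #|` E| => k_gt0 cardK /fsubsetP sB /fsubsetP sJ.
have [t nz_t gen_t] := finField_generator K.
pose idx z := index z E.
have lt_idx z : z \in E -> (idx z < k)%N by rewrite index_mem.
have idx_inj : {in E &, injective idx}.
  by move=> z1 z2 z1E z2E e; rewrite -(nth_index z1 z1E) -/(idx z1) e nth_index.
have lt_m : (k ^ 2 < 2 * k ^ 2)%N by rewrite mul2n -addnn -{1}[(k ^ 2)%N]addn0
  ltn_add2l expn_gt0 k_gt0.
have lt_e z1 z2 : z1 \in E -> z2 \in E -> (k * idx z1 + idx z2 < k ^ 2)%N.
  move=> /lt_idx l1 /lt_idx l2; rewrite -mulnn.
  apply: (@leq_trans (k * (idx z1).+1)%N);
    first by rewrite mulnS addnC ltn_add2r.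
  by rewrite leq_mul2l l1 orbT.
have le_idx z : z \in E -> (idx z < k ^ 2)%N.
  move=> /lt_idx l; apply: leq_trans l _.
  by rewrite -mulnn leq_pmull.
have le_kidx z : z \in E -> (k * idx z < k ^ 2)%N.
  by move=> /lt_idx l; rewrite -mulnn ltn_mul2l k_gt0.
(* The exponent of x_i y_j has the indices of j and i as its base-k digits, so these exponents are
   distinct and below k^2, the exponent of [om]; all stay below 2 k^2. *)
exists (fun i => t ^+ idx i), (fun j => t ^+ (k * idx j)), (t ^+ (k ^ 2));
  split.
- by rewrite expf_neq0.
- move=> z s0; apply: (@powers_combination0 _ _ h _ _ _ _ idx z (k ^ 2) 0 cardK
    gen_t).
  + exact: fset_uniq.
  + by move=> z1 z2 /sB ? /sB ?; apply: idx_inj.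
  + by move=> z1 /sB/le_idx/ltn_trans; apply.
  + exact: lt_m.
  + by move=> z1 /sB/le_idx; rewrite ltn_neqAle => /andP[].
  by rewrite s0 rmorph0 mulr0 addr0.
- move=> z s0; apply: (@powers_combination0 _ _ h _ _ _ _
      (fun j => k * idx j)%N z (k ^ 2) 0 cardK gen_t).
  + exact: fset_uniq.
  + move=> z1 z2 /sJ ? /sJ ? /eqP; rewrite eqn_pmul2l // => /eqP.
    exact: idx_inj.
  + by move=> z1 /sJ/le_kidx/ltn_trans; apply.
  + exact: lt_m.
  + by move=> z1 /sJ/le_kidx; rewrite ltn_neqAle => /andP[].
  by rewrite s0 rmorph0 mulr0 addr0.
move=> z a s0 i j iB jJ.
apply: (@powers_combination0 _ _ h _ _ _ [seq (j, i) | j <- J, i <- B]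
  (fun p => k * idx p.1 + idx p.2)%N (fun p => z p.2 p.1) (k ^ 2) a cardK gen_t
    _ _ _ lt_m _ _ (j, i)).
- by apply: allpairs_uniq; rewrite ?fset_uniq // => -[? ?] [? ?].
- move=> _ _ /allpairsP[[j1 i1] /= [/sJ j1E /sB i1E ->]]
    /allpairsP[[j2 i2] /= [/sJ j2E /sB i2E ->]] /= e.
  (* Quotient and remainder by [k] recover the two indices. *)
  have := congr1 (divn^~ k) e; have := congr1 (modn^~ k) e.
  rewrite /= ![(k * _)%N]mulnC !modnMDl !divnMDl // !modn_small ?lt_idx //.
  rewrite !divn_small ?lt_idx // !addn0.
  by move=> /idx_inj -> // /idx_inj ->.
- move=> _ /allpairsP[[j1 i1] /= [/sJ j1E /sB i1E ->]] /=.
  exact: ltn_trans (lt_e _ _ j1E i1E) lt_m.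
- move=> _ /allpairsP[[j1 i1] /= [/sJ j1E /sB i1E ->]] /=.
  by have := lt_e _ _ j1E i1E; rewrite ltn_neqAle => /andP[].
- rewrite big_allpairs /= -[RHS]s0; congr (_ + _); apply: eq_bigr => j1 _.
  by rewrite mulr_sumr; apply: eq_bigr => i1 _; rewrite exprD mulrA.
by apply/allpairsP; exists (j, i).
Qed.

End GenericScalars.

(** * Assembly: the relaxation pair and the common minor *)

Theorem theorem1p1 (U : choiceType)
    (U_infinite : forall A : {fset U}, exists x : U, x \notin A)
    (F : finFieldType) (q : nat) (Fq : #|F| = q)
    (N : matroid U) (k : nat) (Nk : #|` ground N| = k)
    (B : {fset U}) (NB : B \in bases N)
    (M : matroid U) (MF : representable F M) (MN : fragile N M)
    (K : finFieldType) (Kq : #|K| = q ^ (2 * k ^ 2)) :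
  exists (M1 M2 : matroid U) (c d : U),
    [/\ ground M1 = ground M2,
        representable K M1 /\ representable K M2,
        [/\ c \in ground M1, d \in ground M1 & c != d],
        exists H : {fset U}, relaxation_at M1 H M2
      & deletion (contraction M B) (ground N `\` B)
        = deletion (contraction M1 [fset c]) [fset d]].
Proof.
have [[sNM [C [D [disCD eU eN]]]] _] := MN; have [r [v rep]] := MF.
(* For k = 0 the field [K] would have a single element. *)
have k_gt0 : 0 < k.
  rewrite lt0n; apply/eqP=> k0; have := finNzRing_gt1 K.
  by rewrite Kq k0 muln0 expn0.
rewrite -Fq -Nk in Kq k_gt0.
have [h] := finField_embedding Kq.
have sBN := base_sub NB; pose J := ground N `\` B.
have [x [y [om [nz_om ix iy iyx]]]] :=
  generic_scalars h k_gt0 Kq sBN (fsubsetDl (ground N) B).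
have [c c_new] := U_infinite (ground M).
have [d d_new] := U_infinite (c |` ground M).
move: d_new; rewrite in_fset1U negb_or => /andP[neq_dc d_new].
have neq_cd : c != d by rewrite eq_sym.
have sCDM : C `|` D `<=` ground M by rewrite eU fsubsetDl.
have [f0 df0] := ffree_dual (fragile_ffree_BC NB rep MN disCD eU eN).
have disB : [disjoint B & C `|` D]%fset.
  by apply/fdisjointP=> z /(fsubsetP sBN) zN; rewrite eU in_fsetD zN.
have vBC : {in D `|` J, forall e, v e \in fspan v (B `|` C)}.
  move=> e eDJ; apply: (fragile_fspan NB rep MN disCD eU eN).
  move: eDJ; rewrite in_fsetU => /orP[eD|]; last first.
    by rewrite in_fsetD => /andP[_ /(fsubsetP sNM)].
  by apply: (fsubsetP sCDM); rewrite in_fsetU eD orbT.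
have cCD : c \notin C `|` D by apply: contra c_new; apply: (fsubsetP sCDM).
have dCD : d \notin C `|` D by apply: contra d_new; apply: (fsubsetP sCDM).
pose V1 := new_family h v f0 B J x y c d 0%R;
  pose V2 := new_family h v f0 B J x y c d om.
pose E := new_ground C D c d.
have rel := relaxation_new_family disB disCD df0 vBC
  (fragile_nzC NB rep MN disCD eU eN df0) (fragile_nzD NB rep MN disCD eU eN
    df0)
  (fragile_change NB rep MN disCD eU eN df0) ix iy iyx nz_om cCD dCD neq_cd.
exists (vec_matroid V1 E), (vec_matroid V2 E), c, d; split=> //.
- by split; [exists (1 + r)%N, V1|exists (1 + r)%N, V2] => X sX;
    apply: vec_matroid_independent.
- by rewrite /= /E /new_ground !inE !eqxx orbT.
- by exists (d |` C).
have sB : B `<=` ground M by apply: fsubset_trans sNM.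
have sc : [fset c] `<=` E by rewrite fsub1set fset1U1.
have gCD : ground M `\` B `\` (ground N `\` B) = C `|` D.
  rewrite eU; apply/fsetP=> z; rewrite !inE.
  by have := fsubsetP sBN z; case: (z \in B) => [->|] //; rewrite ?andbF.
(* Both minors live on [C] + [D] and are compared through ranks, that is, dimensions of spans. *)
apply/minorP => //=.
  rewrite gCD /E /new_ground; apply/fsetP=> z;
    rewrite !in_fsetD !in_fset1U !in_fset1.
  have [->|] := eqVneq z d; first by rewrite (negPf dCD).
  by have [->|] := eqVneq z c; first by rewrite (negPf cCD).
move=> X; rewrite gCD => sX; rewrite minor_independent ?gCD //.
have sXM : X `<=` ground M by apply: fsubset_trans sCDM.
have sXE : X `<=` E.
  by apply: fsubset_trans sX _; apply/fsubsetP=> z zCD;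
    rewrite /E /new_ground !in_fset1U zCD !orbT.
have rep0 : forall Y, Y `<=` ground (vec_matroid V1 E) ->
  independent (vec_matroid V1 E) Y = ffree V1 Y by move=> Y;
    apply: vec_matroid_independent.
have fcS S : S `<=` C `|` D -> ffree V1 (c |` S) = ffree v (B `|` S).
  by move=> sS; exact: (ffree_contract h J x y disB df0 cCD dCD 0%R sS).
have fc : ffree V1 [fset c].
  have := fcS _ (fsub0set _); rewrite !fsetU0 => ->.
  by apply: ffree_sub (dual_ffree df0); apply: fsubsetUl.
have fB : ffree v B by apply: ffree_sub (dual_ffree df0); exact: fsubsetUl.
rewrite !(rank_fspan rep) ?fsubUset ?sXM ?sB // !(rank_fspan rep0) ?fsubUset
  ?sXE ?sc //.
(* The two rank conditions become freeness of [X] + [B] in [v] and of [X] + [c] in [V1], which [fcS]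
   equates. *)
rewrite !dim_ffreeU //.
- by rewrite fsetUC -(fcS _ sX) fsetUC.
- rewrite fdisjointX1; apply: contra cCD; exact: (fsubsetP sX).
by rewrite fdisjoint_sym; apply: fdisjointWr disB.
Qed.
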